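(* Let $\mathbf{X}^*=\mathbf{D}^*\mathbf{A}^*\in\mathbb{R}^{n_1\times n_2}$ with $\mathbf{D}^*\in\mathbb{R}^{n_1\times r}$, $\mathbf{A}^*\in\mathbb{R}^{r\times n_2}$, $r\le n_2$, $\|\mathbf{D}^*\|_{\max}\le 1$, $\|\mathbf{A}^*\|_{\max}\le \mathrm{A}_{\max}$, $\|\mathbf{X}^*\|_{\max}\le \mathrm{X}_{\max}/2$, where $0<\mathrm{A}_{\max}\le n_1\vee n_2$ and $\mathrm{X}_{\max}\ge 1$. Let $m$ be an integer with $4\le m\le n_1n_2$, $\gamma=m(n_1n_2)^{-1}$, and let $\mathcal{S}\subseteq[n_1]\times[n_2]$ be drawn from the independent Bernoulli($\gamma$) model. Given $\mathcal{S}$, suppose the observations $Y_{i,j}$, $(i,j)\in\mathcal{S}$, are independent, $Y_{i,j}$ having the Laplace density $y\mapsto\frac{\tau}{2}\exp(-\tau|y-X^*_{i,j}|)$ with parameter $\tau>0$. Let $$\beta=\max\left\{1,\,1+\frac{\log(8r\mathrm{A}_{\max}/\mathrm{X}_{\max})}{\log(n_1\vee n_2)}\right\},\qquad \lambda=2\left(1+\frac{2C_{\mathrm D}}{3}\right)(\beta+2)\log(n_1\vee n_2),\qquad C_{\mathrm D}=2\tau\mathrm{X}_{\max},$$ let $\mathcal{X}=\mathcal{X}'$ (the class of discretized candidates with parameter $\beta$ defined in the context), and let $$\widehat{\mathbf{X}}=\arg\min_{\mathbf{X}=\mathbf{D}\mathbf{A}\in\mathcal{X}}\left\{-\log p_{\mathbf{X}_{\mathcal{S}}}(\mathbf{Y}_{\mathcal{S}})+\lambda\|\mathbf{A}\|_0\right\}.$$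 Then: (1) When $\mathbf{A}^*$ is exactly sparse, having $\|\mathbf{A}^*\|_0$ nonzero elements, $$\frac{\mathbb{E}_{\mathcal{S},\mathbf{Y}_{\mathcal{S}}}\left[\|\mathbf{X}^*-\widehat{\mathbf{X}}\|_F^2\right]}{n_1n_2}=\mathcal{O}\left(\left(\frac1\tau+\mathrm{X}_{\max}\right)^2\tau\mathrm{X}_{\max}\left(\frac{n_1r+\|\mathbf{A}^*\|_0}{m}\right)\log(n_1\vee n_2)\right).$$ (2) If, instead, for some $p\le 1/2$ the columns of $\mathbf{A}^*$ belong to a weak-$\ell_p$ ball of radius $\mathrm{A}_{\max}$, then with $\alpha'=1/p-1$, $$\frac{\mathbb{E}_{\mathcal{S},\mathbf{Y}_{\mathcal{S}}}\left[\|\mathbf{X}^*-\widehat{\mathbf{X}}\|_F^2\right]}{n_1n_2}=\mathcal{O}\left(\left(\frac1\tau+\mathrm{X}_{\max}\right)^2\tau\mathrm{A}_{\max}\left(\frac{n_2}{m}\right)^{\frac{\alpha'}{\alpha'+1}}+\left(\frac1\tau+\mathrm{X}_{\max}\right)^2\tau\mathrm{X}_{\max}\left(\frac{n_1r}{m}+\left(\frac{n_2}{m}\right)^{\frac{\alpha'}{\alpha'+1}}\right)\log(n_1\vee n_2)\right).$$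
   Context: Notation: $[n]=\{1,\dots,n\}$; $a\vee b=\max\{a,b\}$; $\log$ is the natural logarithm; $\|\mathbf{M}\|_0$ is the number of nonzero entries of $\mathbf{M}$, $\|\mathbf{M}\|_{\max}$ the largest absolute value of an entry, $\|\cdot\|_F$ the Frobenius norm. $\mathcal{O}(\cdot)$ suppresses leading (universal numerical) constants. In the independent Bernoulli($\gamma$) model each $(i,j)$ is included in $\mathcal{S}$ independently with probability $\gamma$. The likelihood of a candidate $\mathbf{X}$ is $p_{\mathbf{X}_{\mathcal{S}}}(\mathbf{Y}_{\mathcal{S}})=(\tau/2)^{|\mathcal{S}|}\exp\left(-\tau\sum_{(i,j)\in\mathcal{S}}|Y_{i,j}-X_{i,j}|\right)$. For $0<p\le1$, a vector $\mathbf{x}\in\mathbb{R}^n$ belongs to the weak-$\ell_p$ ball of radius $R>0$ if its entries ordered by decreasing magnitude, $|x_{(1)}|\ge\dots\ge|x_{(n)}|$, satisfy $|x_{(i)}|\le R\,i^{-1/p}$ for all $i\in\{1,\dots,n\}$. Candidate class: set $L_{\rm lev}=2^{\lceil\log_2 (n_1\vee n_2)^{\beta}\rceil}$. Let $\mathcal{D}$ be the set of all $\mathbf{D}\in\mathbb{R}^{n_1\times r}$ whose entries each take one of $L_{\rm lev}$ uniformly-spaced levels (endpoints included) in $[-1,1]$, and let $\mathcal{A}$ be the set of all $\mathbf{A}\in\mathbb{R}^{r\times n_2}$ whose entries are each either zero or one of $L_{\rm lev}$ uniformly-spaced levels (endpoints included) in $[-\mathrm{A}_{\max},\mathrm{A}_{\max}]$.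 Then $\mathcal{X}'=\{\mathbf{X}=\mathbf{D}\mathbf{A}:\mathbf{D}\in\mathcal{D},\ \mathbf{A}\in\mathcal{A},\ \|\mathbf{X}\|_{\max}\le\mathrm{X}_{\max}\}$. Minimization over $\mathbf{X}=\mathbf{D}\mathbf{A}\in\mathcal{X}$ means over pairs $(\mathbf{D},\mathbf{A})\in\mathcal{D}\times\mathcal{A}$ with $\mathbf{D}\mathbf{A}\in\mathcal{X}$; $\widehat{\mathbf X}$ is the product of a minimizing pair.
   Formalization: The constant in O(·) is not universal: for each t0>0 there is one constant valid whenever τX_max ≥ t0; with a universal constant both bounds fail as τX_max → 0, because λ stays at least 2(β+2)log(n1∨n2). *)

(* Defs.v *)
From mathcomp Require Import all_boot all_order all_algebra.
From mathcomp Require Import all_classical all_reals all_analysis.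

Set Implicit Arguments.
Unset Strict Implicit.
Unset Printing Implicit Defensive.

Import Order.TTheory GRing.Theory Num.Theory.
Import numFieldNormedType.Exports.

Local Open Scope classical_set_scope.
Local Open Scope ring_scope.

(* The max norm of a matrix M is the library norm `|M| of 'M[R]_(n1, n2). *)

Definition l0norm (R : realType) (n1 n2 : nat) (M : 'M[R]_(n1, n2)) : nat :=
  #|[set ij : 'I_n1 * 'I_n2 | M ij.1 ij.2 != 0]%SET|.

Definition frobenius (R : realType) (n1 n2 : nat) (M : 'M[R]_(n1, n2)) : R :=
  Num.sqrt (\sum_i \sum_j M i j ^+ 2).

(* The i-th entry, counted from 0, of the sequence below is |x_(i+1)|. *)
Definition weak_lp_ball (R : realType) (n : nat) (p rad : R) : set 'cV[R]_n :=
  [set x | forall i : nat, (i < n)%N ->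
    nth 0 (sort >=%O [seq `|x k 0| | k <- enum 'I_n]) i
      <= rad * i.+1%:R `^ (- p^-1)].

Definition laplace_pdf (R : realType) (tau mu y : R) : R :=
  tau / 2 * expR (- (tau * `|y - mu|)).

(* Y i j is the observation at (i, j); it is never used when (i, j) \notin S. *)
Definition likelihood (R : realType) (n1 n2 : nat) (tau : R)
    (S : {set 'I_n1 * 'I_n2}) (Y X : 'M[R]_(n1, n2)) : R :=
  (tau / 2) ^+ #|S| *
  expR (- (tau * \sum_(ij in S) `|Y ij.1 ij.2 - X ij.1 ij.2|)).

(* The indicators of the events (i, j) \in S are independent Bernoulli(gamma)
   variables, i.e. they have the product law on subsets. *)
Definition bernoulli_sampling (R : realType) (d : measure_display)
    (T : measurableType d) (P : probability T R) (n1 n2 : nat) (gamma : R)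
    (S : T -> {set 'I_n1 * 'I_n2}) : Prop :=
  forall s : {set 'I_n1 * 'I_n2},
    measurable [set w | S w = s] /\
    P [set w | S w = s] =
      (\prod_ij (if ij \in s then gamma else 1 - gamma))%:E.

(* Given S = s, the observations at the positions of s are independent with
   Laplace densities centred at the entries of Xstar. The conditional law is
   written multiplied by P(S = s), so that null events S = s are harmless.
   Nothing is assumed about Y i j on the event (i, j) \notin S. *)
Definition laplace_observations (R : realType) (d : measure_display)
    (T : measurableType d) (P : probability T R) (n1 n2 : nat) (tau : R)
    (Xstar : 'M[R]_(n1, n2)) (S : T -> {set 'I_n1 * 'I_n2})
    (Y : T -> 'M[R]_(n1, n2)) : Prop :=
  (forall i j, measurable_fun setT (fun w => Y w i j)) /\
  forall (s : {set 'I_n1 * 'I_n2}) (B : 'I_n1 -> 'I_n2 -> set R),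
    (forall i j, measurable (B i j)) ->
    P [set w | S w = s /\
               forall i j, (i, j) \in s -> B i j (Y w i j)] =
    (P [set w | S w = s] *
     \prod_(ij in s) \int[lebesgue_measure]_(y in B ij.1 ij.2)
                       (laplace_pdf tau (Xstar ij.1 ij.2) y)%:E)%E.

(* With ln 0 = 0, the degenerate case r = 0 gives beta = 1, which is also what
   the convention log 0 = -oo gives. *)
Definition beta_par (R : realType) (n1 n2 r : nat) (Amax Xmax : R) : R :=
  Num.max 1 (1 + ln (8 * r%:R * Amax / Xmax) / ln (maxn n1 n2)%:R).

Definition lambda_par (R : realType) (n1 n2 : nat) (tau Xmax beta : R) : R :=
  let CD := 2 * tau * Xmax in
  2 * (1 + 2 * CD / 3) * (beta + 2) * ln (maxn n1 n2)%:R.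

(* The ceiling is nonnegative when beta >= 0 and n1 or n2 is positive, so the
   absolute value is only a cast to nat. *)
Definition Llev (R : realType) (n1 n2 : nat) (beta : R) : nat :=
  (2 ^ `|Num.ceil (ln ((maxn n1 n2)%:R `^ beta) / ln 2)|%N)%N.

Definition levels (R : realType) (L : nat) (a : R) : set R :=
  [set x | exists2 k : nat, (k < L)%N & x = - a + 2 * a * k%:R / L.-1%:R].

Definition Dclass (R : realType) (n1 r L : nat) : set 'M[R]_(n1, r) :=
  [set D | forall i k, levels L 1 (D i k)].

Definition Aclass (R : realType) (r n2 L : nat) (Amax : R) :
    set 'M[R]_(r, n2) :=
  [set A | forall k j, A k j = 0 \/ levels L Amax (A k j)].

Definition Xclass (R : realType) (n1 n2 r L : nat) (Amax Xmax : R) :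
    set 'M[R]_(n1, n2) :=
  [set X | exists (D : 'M[R]_(n1, r)) (A : 'M[R]_(r, n2)),
    [/\ Dclass L D, Aclass L Amax A, X = D *m A & `|X| <= Xmax]].

Definition admissible (R : realType) (n1 n2 r L : nat) (Amax Xmax : R)
    (D : 'M[R]_(n1, r)) (A : 'M[R]_(r, n2)) : Prop :=
  [/\ Dclass L D, Aclass L Amax A & Xclass r L Amax Xmax (D *m A)].

Definition objective (R : realType) (n1 n2 r : nat) (tau lambda : R)
    (S : {set 'I_n1 * 'I_n2}) (Y : 'M[R]_(n1, n2))
    (D : 'M[R]_(n1, r)) (A : 'M[R]_(r, n2)) : R :=
  - ln (likelihood tau S Y (D *m A)) + lambda * (l0norm A)%:R.

Definition is_estimate (R : realType) (n1 n2 r L : nat)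
    (Amax Xmax tau lambda : R) (S : {set 'I_n1 * 'I_n2})
    (Y Xhat : 'M[R]_(n1, n2)) : Prop :=
  exists (D : 'M[R]_(n1, r)) (A : 'M[R]_(r, n2)),
    [/\ admissible L Amax Xmax D A, Xhat = D *m A &
      forall (D' : 'M[R]_(n1, r)) (A' : 'M[R]_(r, n2)),
        admissible L Amax Xmax D' A' ->
        objective tau lambda S Y D A <= objective tau lambda S Y D' A'].

Definition mean_sq_error (R : realType) (d : measure_display)
    (T : measurableType d) (P : probability T R) (n1 n2 : nat)
    (Xstar : 'M[R]_(n1, n2)) (Xhat : T -> 'M[R]_(n1, n2)) : \bar R :=
  ('E_P[(fun w => (frobenius (Xstar - Xhat w) ^+ 2)%R)] / (n1 * n2)%:R%:E)%E.

(* Main.v *)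
Require Import Defs.
From mathcomp Require Import all_boot all_order all_algebra.
From mathcomp Require Import all_classical all_reals all_analysis.
From mathcomp Require Import measurable_realfun.
From mathcomp Require Import ring lra.

Import Order.TTheory GRing.Theory Num.Theory.
Import numFieldNormedType.Exports.

(* Write a(X) for the Hellinger affinity of the Laplace laws with means X* and X
   at one entry. The square root of the likelihood ratio of X and X* on the
   sample has expectation prod (1 - gamma + gamma a(X)), which is at most
   exp(- gamma sum (1 - a(X))). Weighting the candidates by a prefix code of
   length n1 r ln L + (beta + 2) ln N ||A||_0 + 2 (a Kraft sum, because
   L N^-(beta + 2) r n2 <= 2) and using v <= e^v gives, for the penalized
   maximum likelihood estimate and any fixed candidate X,
     gamma E sum (1 - a(Xhat)) <=
       3 + n1 r ln L + lambda/2 ||A||_0 + tau/2 E sum_S |X* - X|,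
   since lambda/2 dominates the code length per nonzero entry. A quadratic lower
   bound 1 - a >= c (X* - Xhat)^2 / (1/tau + Xmax)^2 turns this into a bound on
   the error; X is a rounding of D* times A*, truncated to its largest entries in
   each column for part (2). *)

Set Implicit Arguments.
Unset Strict Implicit.

Local Open Scope classical_set_scope.
Local Open Scope ring_scope.

(** * Affinity of two Laplace laws *)

(** The estimate depends on the data, so an expectation bound for a fixed candidate does not apply
    to it. Bounding its term by the sum over all codes removes this dependence and leads directly to
    a bound in expectation. Square roots are needed: a full likelihood ratio has mean 1 for every
    candidate and shows no distance from X*, while the mean of its root decays with the affinity
    gaps. The Laplace log-density is tau-Lipschitz in its centre, so the bias of the fixed candidate
    enters to first order. This explains the size of beta: it makes the rounding error at most Xmax
    / (2 N), and for r > 0 the resulting bias of order tau Xmax / N is below the order tau Xmax n1 r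
    / m of the main term, because m <= n1 n2 <= N n1 r. The fixed candidate must itself lie in the
    class. The assumption on X* leaves a margin of Xmax / 2, of which truncation and rounding may
    each use Xmax / 4. *)

Section laplace_integrals.
Context {R : realType}.
Local Notation mu := (@lebesgue_measure R).
Implicit Types a b k v tau : R.

Lemma continuous_expR_affine v k : continuous (fun y : R => expR (v + k * y)).
Proof.
move=> y; apply: continuous_comp; last exact: continuous_expR.
apply: (@continuousD _ R^o); first exact: cst_continuous.
by apply: continuousM => //; exact: cst_continuous.
Qed.

Lemma integral_expR_itvcy v k a : 0 < k ->
  (\int[mu]_(y in `[a, +oo[) (expR (v - k * y))%:E =
    (expR (v - k * a) / k)%:E)%E.
Proof.
move=> k0.
have cf : continuous (fun y : R => expR (v - k * y)).
  by under eq_fun do rewrite -mulNr; exact: continuous_expR_affine.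
have dF (y : R) : is_derive (y : R^o) 1 (fun y : R^o => - (expR (v - k * y) / k) : R^o) (expR (v - k * y)).
  have D2 : is_derive (y : R^o) 1 (fun y : R^o => v - k * y : R^o) (- k).
    have := is_deriveB (is_derive_cst (v : R^o) (y : R^o) 1) (is_deriveZ k (is_derive_id (y : R^o) 1)).
    by move/is_derive_eq; apply; rewrite [k *: 1]mulr1 sub0r.
  have D3 := @is_derive1_comp R expR (fun y => v - k * y) y _ _ (is_derive_expR (v - k * y)) D2.
  have := is_deriveN (is_deriveZ k^-1 D3).
  rewrite (_ : - (k^-1 *: _) = (fun y : R^o => - (expR (v - k * y) / k) : R^o)); last first.
    by apply/funext => z /=; rewrite fctE /= /GRing.scale /= mulrC.
  move/is_derive_eq; apply.
  by rewrite /GRing.scale /=; field; rewrite gt_eqF.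
rewrite (@ge0_continuous_FTC2y _ _ (fun y => - (expR (v - k * y) / k)) _ 0)//.
- by rewrite EFinN oppeK add0e.
- by apply: continuous_subspaceT.
- rewrite -[X in _ --> X]oppr0; apply: cvgN.
  rewrite -[X in _ --> X](mul0r k^-1); apply: cvgM; last exact: cvg_cst.
  rewrite (_ : (fun x => _) = (fun x => expR v * expR (- (k * x)))); last first.
    by apply/funext => x; rewrite -expRD.
  rewrite -[X in _ --> X](mulr0 (expR v)).
  apply: cvgM; first exact: cvg_cst.
  apply: (@cvg_comp _ _ _ (fun x => k * x) (fun z => expR (- z)) _ (pinfty_nbhs R)); last exact: cvgr_expR.
  exact: gt0_cvgMry.
- apply: cvg_at_right_filter; apply: cvgN; apply: cvgM; last exact: cvg_cst.
  exact: cf.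
- by move=> y _; rewrite derive1E; apply: derive_val.
Qed.

Lemma integral_expR_itvNyc v k a : 0 < k ->
  (\int[mu]_(y in `]-oo, a]) (expR (v + k * y))%:E =
    (expR (v + k * a) / k)%:E)%E.
Proof.
move=> k0; rewrite -[in LHS](opprK a).
rewrite ge0_integration_by_substitutionNy; last 2 first.
- by apply: continuous_subspaceT; exact: continuous_expR_affine.
- by move=> x _; exact: expR_ge0.
rewrite -[a in RHS]opprK mulrN -integral_expR_itvcy//.
by apply: eq_integral => x _; rewrite /= mulrN.
Qed.

(* The square root of the ratio of the Laplace densities centred at b and a. *)
Definition laplace_tilt tau a b (y : R) : R :=
  expR (tau / 2 * (`|y - a| - `|y - b|)).

Lemma laplace_tilt_ge0 tau a b y : 0 <= laplace_tilt tau a b y.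
Proof. exact: expR_ge0. Qed.

Lemma laplace_pdf_ge0 tau a y : 0 < tau -> 0 <= laplace_pdf tau a y.
Proof. by move=> t0; rewrite mulr_ge0 ?expR_ge0// divr_ge0// ltW. Qed.

Lemma measurable_laplace_tilt tau a b :
  measurable_fun setT (laplace_tilt tau a b).
Proof.
apply: measurableT_comp => //; apply: measurable_funM => //.
by apply: measurable_funB; apply: measurableT_comp => //; exact: measurable_funB.
Qed.

Lemma measurable_laplace_pdf tau a : measurable_fun setT (laplace_pdf tau a).
Proof.
apply: measurable_funM => //; apply: measurableT_comp => //.
apply: measurableT_comp => //; apply: measurable_funM => //.
by apply: measurableT_comp => //; exact: measurable_funB.
Qed.

Lemma laplace_tilt_pdfE tau a b y :
  laplace_tilt tau a b y * laplace_pdf tau a y =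
  tau / 2 * expR (- (tau / 2) * (`|y - a| + `|y - b|)).
Proof.
rewrite /laplace_tilt /laplace_pdf mulrCA -expRD; congr (_ * expR _).
by field.
Qed.

(** For a <= b the sum |y - a| + |y - b| is constant on [a, b] and has slope 2 or -2 outside. Each
    tail contributes e^-u / 2 and the middle u e^-u. The integrand is only bounded by the sum of the
    three restrictions, so the common endpoints of the closed intervals are harmless. *)
Lemma laplace_affinity tau a b : 0 < tau ->
  (\int[mu]_y (laplace_tilt tau a b y * laplace_pdf tau a y)%:E <=
   ((1 + tau / 2 * `|a - b|) * expR (- (tau / 2 * `|a - b|)))%:E)%E.
Proof.
move=> t0; under eq_integral do rewrite laplace_tilt_pdfE.
wlog ab : a b / a <= b.
  move=> H; have [|/ltW] := leP a b; first exact: H.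
  by move/H; rewrite distrC; under eq_integral do rewrite addrC.
rewrite ler0_norm ?subr_le0// opprB.
set u := tau / 2 * (b - a).
have le_of_eq (p q : R) : p = q -> p <= q by move=> ->.
pose f1 y : \bar R := (tau / 2 * expR (- (tau / 2 * (a + b)) + tau * y))%:E.
pose f2 y : \bar R := (tau / 2 * expR (tau / 2 * (a + b) - tau * y))%:E.
pose f3 (y : R) : \bar R := (tau / 2 * expR (- u))%:E.
pose A := `]-oo, a]%classic; pose B := `[b, +oo[%classic; pose C := `[a, b]%classic.
have mA : measurable A by exact: measurable_itv.
have mB : measurable B by exact: measurable_itv.
have mC : measurable C by exact: measurable_itv.
have mf1 : measurable_fun setT f1.
  apply/measurable_EFinP; apply: measurable_funM => //.
  by apply: continuous_measurable_fun; exact: continuous_expR_affine.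
have mf2 : measurable_fun setT f2.
  apply/measurable_EFinP; apply: measurable_funM => //.
  apply: continuous_measurable_fun.
  by under eq_fun do rewrite -mulNr; exact: continuous_expR_affine.
have th : 0 <= tau / 2 by rewrite divr_ge0// ltW.
have f10 y : (0 <= f1 y)%E by rewrite lee_fin mulr_ge0// expR_ge0.
have f20 y : (0 <= f2 y)%E by rewrite lee_fin mulr_ge0// expR_ge0.
have f30 y : (0 <= f3 y)%E by rewrite lee_fin mulr_ge0// expR_ge0.
have I1 : (\int[mu]_(y in A) f1 y = (expR (- u) / 2)%:E)%E.
  under eq_integral do rewrite /f1 EFinM.
  rewrite ge0_integralZl_EFin//; last first.
    apply/measurable_EFinP; apply: measurable_funTS.
    by apply: continuous_measurable_fun; exact: continuous_expR_affine.
  rewrite /A integral_expR_itvNyc// -EFinM; congr (_%:E).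
  rewrite (_ : - (tau / 2 * (a + b)) + tau * a = - u); last by rewrite /u; field.
  by field; rewrite gt_eqF.
have I2 : (\int[mu]_(y in B) f2 y = (expR (- u) / 2)%:E)%E.
  under eq_integral do rewrite /f2 EFinM.
  rewrite ge0_integralZl_EFin//; last first.
    apply/measurable_EFinP; apply: measurable_funTS.
    apply: continuous_measurable_fun.
    by under eq_fun do rewrite -mulNr; exact: continuous_expR_affine.
  rewrite /B integral_expR_itvcy// -EFinM; congr (_%:E).
  rewrite (_ : tau / 2 * (a + b) - tau * b = - u); last by rewrite /u; field.
  by field; rewrite gt_eqF.
have I3 : (\int[mu]_(y in C) f3 y = (u * expR (- u))%:E)%E.
  rewrite integral_cst//= lebesgue_measure_itv /= lte_fin.
  case: ifPn => [_|]; first by rewrite -EFinD -EFinM; congr (_%:E); rewrite /u; ring.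
  rewrite -leNgt => ba; rewrite mule0 /u.
  by rewrite (_ : b = a) ?subrr ?mulr0 ?mul0r//; apply/eqP; rewrite eq_le ba ab.
have m1 : measurable_fun setT (f1 \_ A).
  exact: ((measurable_restrictT _ mA).1 (measurable_funTS mf1)).
have m2 : measurable_fun setT (f2 \_ B).
  exact: ((measurable_restrictT _ mB).1 (measurable_funTS mf2)).
have m3 : measurable_fun setT (f3 \_ C).
  exact: ((measurable_restrictT _ mC).1 (measurable_cst _)).
apply: (@le_trans _ _ (\int[mu]_y ((f1 \_ A) y + (f2 \_ B) y + (f3 \_ C) y))%E).
  apply: ge0_le_integral => //.
  - by move=> y _; rewrite lee_fin mulr_ge0// expR_ge0.
  - apply/measurable_EFinP; apply: measurable_funM => //.
    apply: measurableT_comp => //; apply: measurable_funM => //.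
    by apply: measurable_funD; apply: measurableT_comp => //; exact: measurable_funB.
  - by apply: emeasurable_funD => //; exact: emeasurable_funD.
  - move=> y _.
    have g1 : (0 <= (f1 \_ A) y)%E by apply: erestrict_ge0.
    have g2 : (0 <= (f2 \_ B) y)%E by apply: erestrict_ge0.
    have g3 : (0 <= (f3 \_ C) y)%E by apply: erestrict_ge0.
    have [ya|ay] := leP y a.
      apply: le_trans (leeDl _ g3); apply: le_trans (leeDl _ g2).
      rewrite [X in (_ <= X)%E]patchE ifT; last by rewrite inE /A /= in_itv.
      rewrite /f1 lee_fin.
      rewrite (@ler0_norm _ (y - a)) ?subr_le0// (@ler0_norm _ (y - b)) ?subr_le0 ?(le_trans ya)//.
      by apply: le_of_eq; congr (_ * expR _); field.
    have [yb|yb] := leP y b.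
      apply: (@le_trans _ _ ((f3 \_ C) y)); last by apply: leeDr; exact: adde_ge0.
      rewrite [X in (_ <= X)%E]patchE ifT; last by rewrite inE /C /= in_itv /= yb ltW.
      rewrite /f3 lee_fin.
      rewrite (@ger0_norm _ (y - a)); last by rewrite subr_ge0 ltW.
      rewrite (@ler0_norm _ (y - b)) ?subr_le0//.
      by apply: le_of_eq; congr (_ * expR _); rewrite /u; field.
    apply: le_trans (leeDl _ g3); apply: le_trans (leeDr _ g1).
    rewrite [X in (_ <= X)%E]patchE ifT; last by rewrite inE /B /= in_itv /= ltW.
    rewrite /f2 lee_fin.
    rewrite (@ger0_norm _ (y - a)); last by rewrite subr_ge0 ltW.
    rewrite (@ger0_norm _ (y - b)); last by rewrite subr_ge0 ltW.
    by apply: le_of_eq; congr (_ * expR _); field.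
have p1 y : (0 <= (f1 \_ A) y)%E by apply: erestrict_ge0.
have p2 y : (0 <= (f2 \_ B) y)%E by apply: erestrict_ge0.
have p3 y : (0 <= (f3 \_ C) y)%E by apply: erestrict_ge0.
rewrite ge0_integralD//; last 2 first.
- by move=> y _; exact: adde_ge0.
- exact: emeasurable_funD.
rewrite ge0_integralD//.
rewrite -!integral_mkcond I1 I2 I3 -!EFinD lee_fin.
by apply: le_of_eq; field.
Qed.

End laplace_integrals.

(** * Product densities from their values on rectangles *)

Section product_densities.
Context {R : realType}.
Local Open Scope ereal_scope.

Import HBNNSimple.

Section transfer.
Context d d' (T : measurableType d) (V : measurableType d').
Variables (mu : {measure set T -> \bar R}) (Y : T -> V) (G : T -> R).
Hypotheses (mY : measurable_fun setT Y) (mG : measurable_fun setT G).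
Hypothesis G0 : forall x, (0 <= G x)%R.

Lemma integral_nnsfun_comp (h : {nnsfun V >-> R}) :
  \int[mu]_x (h (Y x) * G x)%:E =
  \sum_(k \in range h) k%:E * \int[mu]_x (\1_(h @^-1` [set k]) (Y x) * G x)%:E.
Proof.
have mI k : measurable_fun setT (fun x => \1_(h @^-1` [set k]) (Y x) * G x)%R.
  by apply: measurable_funM => //; apply: measurableT_comp.
have I0 k x : (0 <= (\1_(h @^-1` [set k]) (Y x) * G x)%:E :> \bar R).
  by rewrite lee_fin mulr_ge0.
have kI0 k x : (0 <= k%:E * (\1_(h @^-1` [set k]) (Y x) * G x)%:E :> \bar R).
  rewrite -EFinM mulrA EFinM mule_ge0 ?lee_fin//.
  exact: nnfun_muleindic_ge0.
transitivity (\int[mu]_x \sum_(k \in range h)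
    k%:E * (\1_(h @^-1` [set k]) (Y x) * G x)%:E).
  apply: eq_integral => x _; rewrite fimfunE EFinM -fsumEFin//.
  rewrite ge0_mule_fsuml.
    by apply: eq_fsbigr => k _; rewrite -!EFinM mulrA.
  by move=> k; exact: nnfun_muleindic_ge0.
rewrite ge0_integral_fsum//; last first.
  by move=> k; apply/measurable_funeM/measurable_EFinP.
apply: eq_fsbigr => k; rewrite inE => -[v _ <-].
by rewrite ge0_integralZl_EFin//; exact/measurable_EFinP.
Qed.

Lemma cvg_integral_approx_comp (f : V -> R)
    (mf : measurable_fun setT (EFin \o f)) :
  (forall v, (0 <= f v)%R) ->
  \int[mu]_x (nnsfun_approx measurableT mf n (Y x) * G x)%:E @[n --> \oo] -->
  \int[mu]_x (f (Y x) * G x)%:E.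
Proof.
move=> f0.
have -> : \int[mu]_x (f (Y x) * G x)%:E =
    \int[mu]_x limn (fun n => (nnsfun_approx measurableT mf n (Y x) * G x)%:E).
  apply: eq_integral => x _; apply/esym/cvg_lim => //.
  under eq_fun do rewrite EFinM.
  rewrite EFinM; apply: cvgeZr => //.
  apply: (@cvg_nnsfun_approx _ _ _ _ measurableT _ mf) => // v _.
  by rewrite lee_fin.
apply: cvg_monotone_convergence => //.
- move=> n; apply/measurable_EFinP; apply: measurable_funM => //.
  exact: measurableT_comp.
- by move=> n x _; rewrite lee_fin mulr_ge0.
- move=> x _ m n mn; rewrite lee_fin ler_wpM2r//.
  exact/lefP/nd_nnsfun_approx.
Qed.

End transfer.

(** The identity passes from indicators to simple functions by linearity and then to [f] by monotone
    convergence; [c] is finite so that multiplication by it commutes with the limit. *)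
Lemma integral_transfer d1 d2 d3 (T1 : measurableType d1)
    (T2 : measurableType d2) (V : measurableType d3)
    (mu1 : {measure set T1 -> \bar R}) (mu2 : {measure set T2 -> \bar R})
    (Y1 : T1 -> V) (Y2 : T2 -> V) (G1 : T1 -> R) (G2 : T2 -> R) (c : \bar R)
    (f : V -> R) :
  measurable_fun setT Y1 -> measurable_fun setT Y2 ->
  measurable_fun setT G1 -> measurable_fun setT G2 ->
  (forall x, (0 <= G1 x)%R) -> (forall x, (0 <= G2 x)%R) -> c \is a fin_num ->
  measurable_fun setT f -> (forall v, (0 <= f v)%R) ->
  (forall B, measurable B ->
    \int[mu1]_x (\1_B (Y1 x) * G1 x)%:E =
    c * \int[mu2]_x (\1_B (Y2 x) * G2 x)%:E) ->
  \int[mu1]_x (f (Y1 x) * G1 x)%:E = c * \int[mu2]_x (f (Y2 x) * G2 x)%:E.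
Proof.
move=> mY1 mY2 mG1 mG2 G10 G20 c0 mf f0 H.
have mf' : measurable_fun setT (EFin \o f) by exact/measurable_EFinP.
have nnapp n : \int[mu1]_x (nnsfun_approx measurableT mf' n (Y1 x) * G1 x)%:E =
    c * \int[mu2]_x (nnsfun_approx measurableT mf' n (Y2 x) * G2 x)%:E.
  rewrite !integral_nnsfun_comp// ge0_mule_fsumr; last first.
    move=> k; have [k0|k0] := leP 0%R k.
      rewrite mule_ge0 ?lee_fin//; apply: integral_ge0 => x _.
      by rewrite lee_fin mulr_ge0.
    rewrite preimage_nnfun0//; under eq_integral do rewrite indic0 mul0r.
    by rewrite integral0 mule0.
  by apply: eq_fsbigr => k _; rewrite H// muleCA.
have C1 := @cvg_integral_approx_comp _ _ _ _ mu1 _ _ mY1 mG1 G10 f mf' f0.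
move: C1; rewrite (funext nnapp) => C1; apply: (cvg_unique _ C1) => //.
by apply: cvgeZl => //; exact: cvg_integral_approx_comp.
Qed.

Lemma indic_prodE (I : finType) (s : {set I}) (V : Type) (B : I -> set V)
    (y : I -> V) :
  (\prod_(i in s) \1_(B i) (y i) =
    \1_[set y : I -> V | forall i, i \in s -> B i (y i)] y :> R)%R.
Proof.
rewrite [RHS]indicE; case: (boolP (y \in _)) => [|/negP yB].
  rewrite inE /= => yB; apply: big1 => i si.
  by rewrite indicE mem_set//; exact: yB.
have [i si yi] : exists2 i, i \in s & ~ B i (y i).
  apply: contrapT => h; apply: yB; rewrite inE /= => i si.
  by apply: contrapT => yi; apply: h; exists i.
by rewrite (bigD1 i)//= indicE memNset// mul0r.
Qed.

Variables (d : measure_display) (T : measurableType d).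
Variables (P : {finite_measure set T -> \bar R}) (I : finType) (s : {set I}).
Variables (E : set T) (Y : T -> I -> R) (q : I -> R -> R).
Hypotheses (mE : measurable E) (mY : forall i, measurable_fun setT (Y ^~ i)).
Hypotheses (mq : forall i, measurable_fun setT (q i)).
Hypotheses (q0 : forall i y, (0 <= q i y)%R).
Hypothesis q_fin : forall i, \int[lebesgue_measure]_y (q i y)%:E < +oo.
Hypothesis PE : forall B : I -> set R, (forall i, measurable (B i)) ->
  P [set w | E w /\ forall i, i \in s -> B i (Y w i)] =
  P E * \prod_(i in s) \int[lebesgue_measure]_(y in B i) (q i y)%:E.

(** Probabilities of rectangles suffice, without a joint density on a product space: replacing the
    indicators by functions one coordinate at a time only involves measures on the line. *)
Lemma integral_prod_density (f : I -> R -> R) :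
  (forall i, measurable_fun setT (f i)) -> (forall i y, (0 <= f i y)%R) ->
  (forall i, \int[lebesgue_measure]_y (f i y * q i y)%:E < +oo) ->
  \int[P]_w (\1_E w * \prod_(i in s) f i (Y w i))%:E =
  P E * \prod_(i in s) \int[lebesgue_measure]_y (f i y * q i y)%:E.
Proof.
(* The coordinates listed in l carry arbitrary functions, the others indicators. *)
pose Q (l : seq I) := forall f : I -> R -> R,
  (forall i, measurable_fun setT (f i)) -> (forall i y, (0 <= f i y)%R) ->
  (forall i, \int[lebesgue_measure]_y (f i y * q i y)%:E < +oo) ->
  (forall i, i \in s -> i \notin l -> exists2 B, measurable B & f i = \1_B) ->
  \int[P]_w (\1_E w * \prod_(i in s) f i (Y w i))%:E =
  P E * \prod_(i in s) \int[lebesgue_measure]_y (f i y * q i y)%:E.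
suff : Q (enum I).
  by move=> + mf f0 ff; apply => // i _; rewrite mem_enum.
elim: (enum I) => [|k l IH] {}f mf f0 ff fB.
  have [B mB fBE] : exists2 B : I -> set R,
      forall i, measurable (B i) & forall i, i \in s -> f i = \1_(B i).
    have /choice[B HB] : forall i, exists B : set R,
        measurable B /\ (i \in s -> f i = \1_B).
      move=> i; case: (boolP (i \in s)) => si; last by exists set0.
      by have [B mB fE] := fB i si isT; exists B.
    by exists B => i; have [] := HB i.
  have mS : measurable [set w | E w /\ forall i, i \in s -> B i (Y w i)].
    rewrite (_ : [set w | _] =
        E `&` \bigcap_(i in [set` s]) (Y ^~ i @^-1` B i)); last first.
      by apply/seteqP; split => w [Ew h]; split => // i; exact: h.
    apply: measurableI => //; apply: fin_bigcap_measurable => // i _.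
    by rewrite -[X in measurable X]setTI; exact: mY.
  transitivity (\int[P]_w (\1_[set w | E w /\
      forall i, i \in s -> B i (Y w i)] w)%:E).
    apply: eq_integral => w _; congr (_%:E).
    rewrite (eq_bigr (fun i => \1_(B i) (Y w i))); last by move=> i si; rewrite fBE.
    rewrite indic_prodE !indicE -natrM mulnb; congr (_%:R); congr nat_of_bool.
    apply/idP/idP.
      by move=> /andP[]; rewrite !inE.
    by rewrite !inE => -[Ew h]; apply/andP; split; rewrite inE.
  rewrite integral_indic// setIT; apply: (etrans (PE mB)); congr (_ * _).
  apply: eq_bigr => i si; rewrite integral_mkcond.
  apply: eq_integral => y _; rewrite fBE// patchE indicE.
  by case: ifPn => _; rewrite ?mul1r ?mul0r.
have [/andP[ks kl]|nk] := boolP ((k \in s) && (k \notin l)); last first.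
  apply: IH => // i si il; apply: fB => //; rewrite inE negb_or il andbT.
  by apply: contraNneq nk => <-; rewrite si.
(* Coordinate [k] is split off. With the other factors frozen in [G1] and [c], the claim is a
   transfer along [Y ^~ k], and its instance for indicators is the induction hypothesis for [f] with
   [f k] replaced by [\1_B]. *)
pose G1 w := (\1_E w * \prod_(i in s | i != k) f i (Y w i))%R.
pose c := P E * \prod_(i in s | i != k) \int[lebesgue_measure]_y (f i y * q i y)%:E.
have fq0 i y : (0 <= f i y * q i y)%R by rewrite mulr_ge0.
have fqi0 i : 0 <= \int[lebesgue_measure]_y (f i y * q i y)%:E.
  by apply: integral_ge0 => y _; rewrite lee_fin.
have mG1 : measurable_fun setT G1.
  apply: measurable_funM; first exact: measurable_indic.
  rewrite /=; under eq_fun do rewrite big_mkcond /=.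
  apply: measurable_prod => i _; case: (_ && _) => //.
  exact: measurableT_comp.
have cfin : c \is a fin_num.
  apply: fin_numM; first exact: (@fin_num_measure _ _ _ P _ mE).
  apply: prode_fin_num => i _.
  by rewrite ge0_fin_numE.
have := @integral_transfer _ _ _ T (measurableTypeR R) R P (@lebesgue_measure R) (Y ^~ k) id G1 (q k) c (f k).
move=> H; transitivity (\int[P]_w (f k (Y w k) * G1 w)%:E).
  apply: eq_integral => w _; congr (_%:E).
  by rewrite (bigD1 k)//= mulrCA.
transitivity (c * \int[lebesgue_measure]_y (f k y * q k y)%:E); last first.
  by rewrite (bigD1 k)//= muleA muleAC.
apply: H => //.
  exact: mq.
  move=> w; rewrite /G1 mulr_ge0//; apply: prodr_ge0 => i _; exact: f0.
move=> B mB; pose f' i := if i == k then \1_B : R -> R else f i.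
have f'B i : f' i = if i == k then \1_B : R -> R else f i by [].
have := IH f'; rewrite (bigD1 k)//= f'B eqxx.
rewrite (eq_bigr (fun i => \int[lebesgue_measure]_y (f i y * q i y)%:E)); last first.
  by move=> i /andP[_ /negbTE ik]; rewrite f'B ik.
move=> H.
transitivity (\int[P]_w (\1_E w * \prod_(i in s) f' i (Y w i))%:E).
  apply: eq_integral => w _; congr (_%:E).
  rewrite (bigD1 k)//= f'B eqxx mulrCA; congr (_ * (_ * _))%R.
  by apply: eq_bigr => i /andP[_ /negbTE ik]; rewrite f'B ik.
rewrite H.
- by rewrite muleCA muleC.
- by move=> i; rewrite f'B; case: ifP => _ //; exact: measurable_indic.
- by move=> i y; rewrite f'B; case: ifP.
- move=> i; rewrite f'B; case: ifP => [/eqP ->|_] //.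
  apply: le_lt_trans (q_fin k); apply: ge0_le_integral => //.
  + by move=> y _; rewrite lee_fin mulr_ge0.
  + by apply/measurable_EFinP; apply: measurable_funM; [exact: measurable_indic | exact: mq].
  + by apply/measurable_EFinP; exact: mq.
  + by move=> y _; rewrite lee_fin ler_piMl// indicE lern1 leq_b1.
- move=> i si il; rewrite f'B; case: ifPn => [_|ik]; first by exists B.
  by apply: fB => //; rewrite inE negb_or ik.
Qed.

End product_densities.
(** * Bernoulli sampling *)

Section bernoulli_sums.
Context {R : realType} {I : finType}.
Implicit Types (g : R) (s : {set I}).

Definition bernoulli_weight g s : R :=
  \prod_i (if i \in s then g else 1 - g).

Lemma sum_bernoulli_weight_prod g (a : I -> R) :
  \sum_(s : {set I}) bernoulli_weight g s * \prod_(i in s) a i =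
  \prod_i (1 - g + g * a i).
Proof.
under [RHS]eq_bigr do rewrite addrC.
rewrite bigA_distr; apply: eq_bigr => s _.
rewrite big_mkcond -big_split /=; apply: eq_bigr => i _.
by case: ifP; rewrite ?mulr1.
Qed.

Lemma sum_bernoulli_weight_card g :
  \sum_(s : {set I}) bernoulli_weight g s * #|s|%:R = g * #|I|%:R.
Proof.
transitivity (\sum_(k : I) \sum_(s : {set I}) bernoulli_weight g s * (k \in s)%:R).
  rewrite exchange_big /=; apply: eq_bigr => s _.
  by rewrite -mulr_sumr -natr_sum -big_mkcond sum1_card.
rewrite -[#|I|]sum1_card natr_sum mulr_sumr; apply: eq_bigr => k _.
(* A zero factor for omitting [k] kills exactly the subsets that miss [k]; the sum over subsets is
   again a product, with factor g at [k] and 1 elsewhere. *)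
transitivity (\sum_(s : {set I}) \prod_i
    (if i \in s then g else if i == k then 0 else 1 - g)).
  apply: eq_bigr => s _; case: (boolP (k \in s)) => ks; last first.
    by rewrite mulr0 (bigD1 k)//= (negbTE ks) eqxx mul0r.
  rewrite mulr1; apply: eq_bigr => i _; case: ifPn => // si.
  by case: eqP => // ik; rewrite ik ks in si.
rewrite -(@bigA_distr _ _ _ _ _ _ (fun=> g) (fun i => if i == k then 0 else 1 - g)).
rewrite (bigD1 k)//= eqxx addr0 big1 ?mulr1// => i /negbTE ->.
by rewrite addrC subrK.
Qed.

Lemma prod_affine_le_expR g (a : I -> R) :
  0 <= g <= 1 -> (forall i, 0 <= a i) ->
  \prod_i (1 - g + g * a i) <= expR (- (g * \sum_i (1 - a i))).
Proof.
move=> /andP[g0 g1] a0; rewrite mulr_sumr -sumrN expR_sum.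
apply: ler_prod => i _; apply/andP; split.
  by rewrite addr_ge0 ?subr_ge0// mulr_ge0.
apply: le_trans (expR_ge1Dx _); rewrite le_eqVlt; apply/orP; left.
by apply/eqP; ring.
Qed.

End bernoulli_sums.

Section sampling.
Context {R : realType} {d : measure_display} {T : measurableType d}.
Variables (P : probability T R) (n1 n2 : nat) (g : R).
Variable S : T -> {set 'I_n1 * 'I_n2}.
Hypothesis HS : bernoulli_sampling P g S.
Implicit Type F : {set 'I_n1 * 'I_n2} -> T -> R.

(** Since [S] has finitely many values, conditioning on it becomes a finite sum over deterministic
    samples. *)
Lemma sampling_splitE F w :
  F (S w) w = \sum_(s : {set 'I_n1 * 'I_n2}) \1_[set w | S w = s] w * F s w.
Proof.
rewrite (bigD1 (S w))//= indicE mem_set// mul1r big1 ?addr0// => s sS.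
by rewrite indicE memNset ?mul0r// => /= h; rewrite h eqxx in sS.
Qed.

Lemma measurable_sampling F : (forall s, measurable_fun setT (F s)) ->
  measurable_fun setT (fun w => F (S w) w).
Proof.
move=> mF; under eq_fun do rewrite sampling_splitE.
apply: measurable_sum => s; apply: measurable_funM => //.
by apply: measurable_indic; have [] := HS s.
Qed.

Lemma integral_sampling F : (forall s, measurable_fun setT (F s)) ->
  (forall s w, 0 <= F s w) ->
  (\int[P]_w (F (S w) w)%:E =
   \sum_(s : {set 'I_n1 * 'I_n2})
      \int[P]_w (\1_[set w | S w = s] w * F s w)%:E)%E.
Proof.
move=> mF F0.
under eq_integral do rewrite sampling_splitE -sumEFin.
rewrite ge0_integral_sum//.
- move=> s; apply/measurable_EFinP; apply: measurable_funM => //.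
  by apply: measurable_indic; have [] := HS s.
- by move=> s w _; rewrite lee_fin mulr_ge0.
Qed.

Lemma expected_sample_size :
  (\int[P]_w (#|S w|%:R)%:E = (g * (n1 * n2)%:R)%:E)%E.
Proof.
rewrite (@integral_sampling (fun s _ => #|s|%:R))//.
have -> : (n1 * n2)%N = #|{: 'I_n1 * 'I_n2}| by rewrite card_prod !card_ord.
rewrite -sum_bernoulli_weight_card -sumEFin; apply: eq_bigr => s _.
have [mS PS] := HS s.
under eq_integral do rewrite EFinM muleC.
rewrite ge0_integralZl_EFin//; last by apply/measurable_EFinP; exact: measurable_indic.
rewrite integral_indic// setIT mulrC EFinM; congr (_ * _)%E.
exact: PS.
Qed.

Variables (tau : R) (Xs : 'M[R]_(n1, n2)) (Y : T -> 'M[R]_(n1, n2)).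
Hypothesis HY : laplace_observations P tau Xs S Y.
Hypothesis tau0 : 0 < tau.

(* The integral of the square root of the product of the two Laplace densities. *)
Definition affinity (X : 'M[R]_(n1, n2)) (ij : 'I_n1 * 'I_n2) : R :=
  let u := tau / 2 * `|Xs ij.1 ij.2 - X ij.1 ij.2| in (1 + u) * expR (- u).

(* The square root of the likelihood ratio of X and Xs on the observed entries. *)
Definition root_ratio (X : 'M[R]_(n1, n2)) (w : T) : R :=
  \prod_(ij in S w)
    laplace_tilt tau (Xs ij.1 ij.2) (X ij.1 ij.2) (Y w ij.1 ij.2).

Lemma measurable_tilt_prod X (s : {set 'I_n1 * 'I_n2}) :
  measurable_fun setT (fun w => \prod_(ij in s)
    laplace_tilt tau (Xs ij.1 ij.2) (X ij.1 ij.2) (Y w ij.1 ij.2)).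
Proof.
under eq_fun do rewrite big_mkcond /=.
apply: measurable_prod => ij _; case: (_ \in _) => //.
apply: measurableT_comp; first exact: measurable_laplace_tilt.
by have [] := HY.
Qed.

Lemma measurable_root_ratio X : measurable_fun setT (root_ratio X).
Proof.
apply: (@measurable_sampling (fun s w => \prod_(ij in s) _)) => s.
exact: measurable_tilt_prod.
Qed.

Lemma affinity_ge0 X ij : 0 <= affinity X ij.
Proof.
rewrite mulr_ge0 ?expR_ge0// addr_ge0// mulr_ge0// divr_ge0//.
exact: ltW.
Qed.

Lemma root_ratio_ge0 X w : 0 <= root_ratio X w.
Proof. by apply: prodr_ge0 => ij _; exact: laplace_tilt_ge0. Qed.

Lemma expected_root_ratio X : 0 <= g <= 1 ->
  (\int[P]_w (root_ratio X w)%:E <=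
   (expR (- (g * \sum_ij (1 - affinity X ij))))%:E)%E.
Proof.
move=> g01.
rewrite (@integral_sampling (fun s w => \prod_(ij in s)
    laplace_tilt tau (Xs ij.1 ij.2) (X ij.1 ij.2) (Y w ij.1 ij.2))); last 2 first.
- exact: measurable_tilt_prod.
- by move=> s w; apply: prodr_ge0 => ij _; exact: laplace_tilt_ge0.
apply: (@le_trans _ _ (\prod_ij (1 - g + g * affinity X ij))%:E); last first.
  by rewrite lee_fin prod_affine_le_expR//; exact: affinity_ge0.
rewrite -sum_bernoulli_weight_prod -sumEFin; apply: lee_sum => s _.
have [mS PS] := HS s; have [mY PY] := HY.
pose q (ij : 'I_n1 * 'I_n2) := laplace_pdf tau (Xs ij.1 ij.2).
pose f (ij : 'I_n1 * 'I_n2) := laplace_tilt tau (Xs ij.1 ij.2) (X ij.1 ij.2).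
have fq ij : (\int[lebesgue_measure]_y (f ij y * q ij y)%:E <= (affinity X ij)%:E)%E.
  exact: laplace_affinity.
(* With equal centres the tilt is 1, so the affinity bound says that the density has integral at
   most 1. *)
have q1 ij : (\int[lebesgue_measure]_y (q ij y)%:E < +oo)%E.
  apply: le_lt_trans (ltry 1).
  have := @laplace_affinity R tau (Xs ij.1 ij.2) (Xs ij.1 ij.2) tau0.
  rewrite subrr normr0 mulr0 addr0 oppr0 expR0 mulr1; apply: le_trans.
  rewrite le_eqVlt; apply/orP; left; apply/eqP; apply: eq_integral => y _.
  by rewrite /laplace_tilt subrr mulr0 expR0 mul1r.
have mYij ij : measurable_fun setT (fun w => Y w ij.1 ij.2) by exact: mY.
have mq ij : measurable_fun setT (q ij) by exact: measurable_laplace_pdf.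
have q0 ij y : 0 <= q ij y by exact: laplace_pdf_ge0.
have ff ij : (\int[lebesgue_measure]_y (f ij y * q ij y)%:E < +oo)%E.
  exact: le_lt_trans (fq ij) (ltry _).
have PB (B : 'I_n1 * 'I_n2 -> set R) : (forall ij, measurable (B ij)) ->
    P [set w | S w = s /\ forall ij, ij \in s -> B ij (Y w ij.1 ij.2)] =
    (P [set w | S w = s] *
      \prod_(ij in s) \int[lebesgue_measure]_(y in B ij) (q ij y)%:E)%E.
  move=> mB; transitivity (P [set w | S w = s /\
      forall i j, (i, j) \in s -> B (i, j) (Y w i j)]).
    congr (P _); apply/seteqP; split => w [Sw h]; split => //.
      by move=> i j; exact: h.
    by move=> [i j]; exact: h.
  rewrite (PY s (fun i j => B (i, j)))//; congr (_ * _)%E.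
  by apply: eq_bigr => -[].
have -> := @integral_prod_density R d T P _ s [set w | S w = s]
  (fun w ij => Y w ij.1 ij.2) q mS mYij mq q0 q1 PB f
  (fun ij => measurable_laplace_tilt _ _ _)
  (fun ij => laplace_tilt_ge0 _ _ _) ff.
apply: (@le_trans _ _ ((bernoulli_weight g s)%:E *
    \prod_(ij in s) \int[lebesgue_measure]_y (f ij y * q ij y)%:E)%E).
  rewrite le_eqVlt; apply/orP; left; apply/eqP; congr (_ * _)%E.
  exact: PS.
rewrite EFinM; apply: lee_wpmul2l.
  have /andP[g0 g1] := g01.
  by rewrite lee_fin; apply: prodr_ge0 => i _; case: ifP; rewrite ?subr_ge0.
have fq0 ij : (0 <= \int[lebesgue_measure]_y (f ij y * q ij y)%:E)%E.
  apply: integral_ge0 => y _; rewrite lee_fin mulr_ge0//.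
  exact: laplace_tilt_ge0.
rewrite -prodEFin.
have : (0 <= \prod_(ij in s) \int[lebesgue_measure]_y (f ij y * q ij y)%:E <=
    \prod_(ij in s) (affinity X ij)%:E)%E.
  elim/big_rec2 : _ => [|ij a b _ /andP[a0 ab]]; first by rewrite lexx lee_fin ler01.
  by rewrite mule_ge0//= lee_pmul.
by move=> /andP[].
Qed.

End sampling.

(** * Entrywise bounds for matrix norms *)

Section matrix_norm.
Context {R : realType} {m n : nat}.
Implicit Type M : 'M[R]_(m, n).

Lemma entry_le_norm M i j : `|M i j| <= `|M|.
Proof.
rewrite /Num.norm /= mx_normrE.
exact: (@le_bigmax _ _ _ 0 (fun ij : 'I_m * 'I_n => `|M ij.1 ij.2|) (i, j)).
Qed.

Lemma norm_le_entries M c : 0 <= c -> (forall i j, `|M i j| <= c) -> `|M| <= c.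
Proof.
move=> c0 H; rewrite [X in X <= _]/Num.norm /= mx_normrE.
by apply: bigmax_le => // ij _; exact: H.
Qed.

Lemma frobenius_sqrE M : frobenius M ^+ 2 = \sum_ij M ij.1 ij.2 ^+ 2.
Proof.
rewrite /frobenius sqr_sqrtr; first by rewrite pair_big.
by apply: sumr_ge0 => i _; apply: sumr_ge0 => j _; exact: sqr_ge0.
Qed.

End matrix_norm.

(** * Codes for the candidates *)

Section codes.
Context {R : realType}.
Variables (n1 r n2 L : nat) (a : R).
Local Notation dcode := {ffun 'I_n1 * 'I_r -> 'I_L}.
Local Notation acode := {ffun 'I_r * 'I_n2 -> option 'I_L}.

(** An explicit function of the index, so that candidates are decoded from a finite type over which
    weights can be summed. *)
Definition level (b : R) (k : nat) : R := - b + 2 * b * k%:R / L.-1%:R.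

Definition decodeD (c : dcode) : 'M[R]_(n1, r) := \matrix_(i, k) level 1 (c (i, k)).

Definition decodeA (c : acode) : 'M[R]_(r, n2) :=
  \matrix_(k, j) if c (k, j) is Some l then level a l else 0.

Definition code_size (c : acode) : nat := #|[set x | c x != None]%SET|.

Lemma Dclass_code D : Dclass L D -> exists c : dcode, D = decodeD c.
Proof.
move=> DD.
have /choice[c Hc] : forall ij : 'I_n1 * 'I_r, exists k : 'I_L, D ij.1 ij.2 = level 1 k.
  by move=> ij; have [k kL ->] := DD ij.1 ij.2; exists (Ordinal kL).
by exists (finfun c); apply/matrixP => i k; rewrite mxE ffunE -Hc.
Qed.

(* A zero entry is always coded by None, even if 0 happens to be a level. *)
Lemma Aclass_code A : Aclass L a A ->
  exists2 c : acode, A = decodeA c & code_size c = l0norm A.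
Proof.
move=> AA.
have /choice[c Hc] : forall ij : 'I_r * 'I_n2, exists o : option 'I_L,
    A ij.1 ij.2 = (if o is Some l then level a l else 0) /\
    (o != None) = (A ij.1 ij.2 != 0).
  move=> ij; have [A0|A0] := eqVneq (A ij.1 ij.2) 0; first by exists None.
  have [/eqP|[k kL Ak]] := AA ij.1 ij.2; first by rewrite (negbTE A0).
  by exists (Some (Ordinal kL)).
exists (finfun c).
  by apply/matrixP => i k; rewrite mxE ffunE; have [] := Hc (i, k).
by apply: eq_card => x; rewrite !inE ffunE; have [] := Hc x.
Qed.

(** The weight is a product over the entries: [None] counts 1 and each of the L levels counts e^-t.
    Distributivity then gives one factor per entry. *)
Lemma sum_code_size (t : R) :
  \sum_(c : acode) expR (- (t * (code_size c)%:R)) =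
  (1 + L%:R * expR (- t)) ^+ (r * n2).
Proof.
pose wt (o : option 'I_L) : R := if o is Some _ then expR (- t) else 1.
transitivity (\sum_(c : acode) \prod_x wt (c x)).
  apply: eq_bigr => c _; rewrite (bigID (fun x => c x != None)) /=.
  rewrite [X in _ = _ * X]big1 ?mulr1; last by move=> x /negPn/eqP ->.
  rewrite (eq_bigr (fun=> expR (- t))); last by move=> x; case: (c x).
  rewrite prodr_const -expRM_natr mulNr; congr (expR (- (t * _%:R))).
  by apply: eq_card => x; rewrite !inE.
rewrite -(@bigA_distr_bigA _ _ _ _ _ _ _ (fun _ o => wt o)) prodr_const.
rewrite card_prod !card_ord; congr (_ ^+ _).
rewrite (bigD1 None)//=; congr (_ + _).
rewrite (eq_bigr (fun=> expR (- t))); last by case.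
rewrite sumr_const -[LHS]mulr_natl; congr (_%:R * _).
by rewrite (eq_card (B := predC1 None)) ?cardC1 ?card_option ?card_ord.
Qed.

Definition candidate (c : dcode * acode) : 'M[R]_(n1, n2) :=
  decodeD c.1 *m decodeA c.2.

Definition code_weight (t : R) (c : dcode * acode) : R :=
  expR (- ((n1 * r)%:R * ln L%:R + t * (code_size c.2)%:R + 2)).

(* The sum over A factors over the entries into (1 + L e^-t)^(r n2) <= e^2. *)
Lemma sum_code_weight_le1 t : (0 < L)%N ->
  (r * n2)%:R * (L%:R * expR (- t)) <= 2 ->
  \sum_(c : dcode * acode) code_weight t c <= 1.
Proof.
move=> L0; set K := (r * n2)%N => Lt.
have -> : \sum_(c : dcode * acode) code_weight t c =
    L%:R ^+ (n1 * r) * expR (- ((n1 * r)%:R * ln L%:R)) *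
    ((1 + L%:R * expR (- t)) ^+ K * expR (- 2)).
  rewrite -sum_code_size mulr_suml.
  transitivity (\sum_(x : dcode) expR (- ((n1 * r)%:R * ln L%:R)) *
      \sum_(y : acode) expR (- (t * (code_size y)%:R)) * expR (- 2)).
    transitivity (\sum_(x : dcode) \sum_(y : acode) code_weight t (x, y)).
      by rewrite pair_big /=; apply: eq_bigr => -[x y] _.
    apply: eq_bigr => x _; rewrite mulr_sumr; apply: eq_bigr => y _.
    by rewrite /code_weight -!expRD /=; congr expR; ring.
  rewrite sumr_const -[LHS]mulr_natl card_ffun card_prod !card_ord natrX.
  by rewrite mulrA -mulr_suml.
rewrite expRN mulrC expRM_natl lnK ?posrE ?ltr0n// divff ?mulr1.
  apply: (@le_trans _ _ (expR (L%:R * expR (- t)) ^+ K * expR (- 2))).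
    rewrite ler_wpM2r ?expR_ge0//.
    have h0 : 0 <= 1 + L%:R * expR (- t) by rewrite addr_ge0// mulr_ge0// expR_ge0.
    by apply: lerXn2r; rewrite ?nnegrE ?expR_ge0 ?expR_ge1Dx.
  by rewrite -expRM_natl -expRD -[X in _ <= X]expR0 ler_expR subr_le0.
by rewrite expf_neq0// pnatr_eq0 -lt0n.
Qed.

End codes.

(** * Oracle inequality *)

Section pointwise.
Context {R : realType}.

(** With v = u / 2, applying e^-v <= 1 / (1 + v) twice gives (1 + u) e^-u <= (1 + 2 v) / (1 + v)^2,
    and the complement of the right side is v^2 / (1 + v)^2. *)
Lemma affinity_gap_ge (u : R) : 0 <= u ->
  (u / 2) ^+ 2 / (1 + u / 2) ^+ 2 <= 1 - (1 + u) * expR (- u).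
Proof.
move=> u0; set v := u / 2.
have v0 : 0 <= v by rewrite divr_ge0.
have uE : u = v + v by rewrite /v; field.
have w0 : 0 < 1 + v by rewrite ltr_pwDl.
have e1 : expR (- v) <= (1 + v)^-1.
  by rewrite expRN lef_pV2 ?posrE ?expR_gt0// expR_ge1Dx.
have -> : v ^+ 2 / (1 + v) ^+ 2 = 1 - (1 + u) * ((1 + v)^-1 * (1 + v)^-1).
  by rewrite uE; field; rewrite gt_eqF.
rewrite lerD2l lerN2 ler_wpM2l ?addr_ge0//.
by rewrite {1}uE opprD expRD ler_pM ?expR_ge0.
Qed.

Variables (n1 n2 : nat) (tau : R) (Xs : 'M[R]_(n1, n2)).
Hypothesis tau0 : 0 < tau.
Implicit Types (X : 'M[R]_(n1, n2)) (ij : 'I_n1 * 'I_n2).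

(** The affinity gap is at most 1, so it controls the square only for bounded errors. Here u / 2 =
    tau D / 4, which gives the 16, and u / 2 <= 3/8 tau Xm allows the denominator 1 + u / 2 to be
    replaced by 1 + tau Xm. *)
Lemma sqr_error_le_affinity X ij Xm : 0 < Xm ->
  `|Xs ij.1 ij.2 - X ij.1 ij.2| <= 3 / 2 * Xm ->
  (Xs ij.1 ij.2 - X ij.1 ij.2) ^+ 2 <=
    16 * (tau^-1 + Xm) ^+ 2 * (1 - affinity tau Xs X ij).
Proof.
move=> Xm0 DX; rewrite /affinity /=.
set D := `|_| in DX *; set u := tau / 2 * D.
have D0 : 0 <= D by rewrite normr_ge0.
have u0 : 0 <= u by rewrite mulr_ge0// divr_ge0// ltW.
apply: le_trans (ler_wpM2l _ (affinity_gap_ge u0)); last first.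
  by rewrite mulr_ge0 ?sqr_ge0.
rewrite -real_normK ?num_real// -/D.
have v0 : 0 < 1 + u / 2 by rewrite ltr_pwDl// divr_ge0.
have -> : 16 * (tau^-1 + Xm) ^+ 2 * ((u / 2) ^+ 2 / (1 + u / 2) ^+ 2) =
    D ^+ 2 * ((1 + tau * Xm) / (1 + u / 2)) ^+ 2.
  have w0 : 1 + u / 2 != 0 by rewrite gt_eqF.
  have tn0 : tau != 0 by rewrite gt_eqF.
  move: (1 + u / 2) w0 => w w0; rewrite /u.
  by field; rewrite w0 tn0.
rewrite ler_peMr ?sqr_ge0//; apply: exprn_ege1.
rewrite ler_pdivlMr// mul1r lerD2l /u.
have := ler_wpM2l (ltW tau0) DX; have := mulr_gt0 tau0 Xm0; lra.
Qed.

Lemma ln_likelihood (S : {set 'I_n1 * 'I_n2}) (Y X : 'M[R]_(n1, n2)) :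
  ln (likelihood tau S Y X) =
  #|S|%:R * ln (tau / 2) - tau * \sum_(ij in S) `|Y ij.1 ij.2 - X ij.1 ij.2|.
Proof.
have t2 : 0 < tau / 2 by rewrite divr_gt0.
rewrite /likelihood lnM ?posrE ?expR_gt0 ?exprn_gt0// expRK lnXn//.
by rewrite mulr_natl.
Qed.

Variables (d : measure_display) (T : measurableType d).
Variables (S : T -> {set 'I_n1 * 'I_n2}) (Y : T -> 'M[R]_(n1, n2)).

Lemma root_ratioE X w : root_ratio S tau Xs Y X w =
  expR (tau / 2 * (\sum_(ij in S w) `|Y w ij.1 ij.2 - Xs ij.1 ij.2| -
    \sum_(ij in S w) `|Y w ij.1 ij.2 - X ij.1 ij.2|)).
Proof. by rewrite -sumrB mulr_sumr expR_sum. Qed.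

Variables (r L : nat) (Am Xm lam th g delta : R).
Variables (DQ : 'M[R]_(n1, r)) (AQ : 'M[R]_(r, n2)).
Hypothesis adQ : admissible L Am Xm DQ AQ.
Hypothesis deltaQ : forall i j, `|Xs i j - (DQ *m AQ) i j| <= delta.
Hypothesis th_lam : 2 * th <= lam.

(** The exponential is the inverse of the bound in [expected_root_ratio], so a root ratio with this
    weight has mean at most [code_weight th c], and these sum to at most 1. *)
Definition tilted_weight (c : {ffun 'I_n1 * 'I_r -> 'I_L} *
    {ffun 'I_r * 'I_n2 -> option 'I_L}) : R :=
  code_weight th c *
  expR (g * \sum_ij (1 - affinity tau Xs (candidate Am c) ij)).

(** The term of the sum at a code of [Xhat] is the exponential of the gap minus the code length plus
    half a log-likelihood ratio. Optimality against [DQ], [AQ] bounds that ratio from below, and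
    half the penalty of [Xhat] covers the part [th * code_size] of its code length. *)
Lemma affinity_gap_le_sum (Xhat : 'M[R]_(n1, n2)) w :
  is_estimate r L Am Xm tau lam (S w) (Y w) Xhat ->
  g * \sum_ij (1 - affinity tau Xs Xhat ij) <=
  \sum_c tilted_weight c * root_ratio S tau Xs Y (candidate Am c) w +
  ((n1 * r)%:R * ln L%:R + 2 + lam / 2 * (l0norm AQ)%:R) +
  tau * delta / 2 * #|S w|%:R.
Proof.
move=> [D [A [[DD AA _] -> /(_ _ _ adQ)]]].
have [c1 Dc] := Dclass_code DD; have [c2 Ac szc] := Aclass_code AA.
rewrite /objective !ln_likelihood -szc => opt.
have -> : D *m A = candidate Am (c1, c2) by rewrite Dc Ac.
(* The misfit of the fixed candidate exceeds that of [Xs] by at most [delta] per observation,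
   whatever the noise. *)
have HQ : \sum_(ij in S w) `|Y w ij.1 ij.2 - (DQ *m AQ) ij.1 ij.2| <=
    \sum_(ij in S w) `|Y w ij.1 ij.2 - Xs ij.1 ij.2| + delta * #|S w|%:R.
  rewrite -sum1_card natr_sum mulr_sumr -big_split /=.
  apply: ler_sum => ij _; rewrite mulr1.
  by apply: le_trans (ler_distD (Xs ij.1 ij.2) _ _) _; rewrite lerD2l.
rewrite (_ : D *m A = candidate Am (c1, c2)) in opt; last by rewrite Dc Ac.
rewrite [X in _ <= X + _ + _](bigD1 (c1, c2))//=.
set rest := \sum_(i | i != (c1, c2)) _.
have rest0 : 0 <= rest.
  apply: sumr_ge0 => c _; apply: mulr_ge0; last exact: root_ratio_ge0.
  by apply: mulr_ge0; exact: expR_ge0.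
rewrite /tilted_weight /code_weight root_ratioE -!expRD /=.
set G := g * _.
set sX := \sum_(ij in S w) `|Y w ij.1 ij.2 - candidate Am (c1, c2) ij.1 ij.2| in opt *.
set sS := \sum_(ij in S w) `|Y w ij.1 ij.2 - Xs ij.1 ij.2| in HQ *.
set sQ := \sum_(ij in S w) `|Y w ij.1 ij.2 - (DQ *m AQ) ij.1 ij.2| in HQ opt *.
(* V is half the log-likelihood ratio of the estimate, penalized and centred;
   [V <= expR V] bounds it by one term of the sum over the codes. *)
set V := (X in expR X).
have eV : V <= expR V by apply: le_trans (expR_ge1Dx V); rewrite lerDr.
have tQ : tau * sQ <= tau * (sS + delta * #|S w|%:R).
  by apply: ler_wpM2l => //; exact: ltW.
have thA : 2 * th * (code_size c2)%:R <= lam * (code_size c2)%:R.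
  exact: ler_wpM2r.
rewrite /V in eV *; move: opt tQ thA eV rest0.
set k := #|S w|%:R; set z := (code_size c2)%:R; set lL := _ * ln L%:R.
set q := (l0norm AQ)%:R; set e := expR _; lra.
Qed.

End pointwise.

Section risk.
Context {R : realType} {d : measure_display} {T : measurableType d}.
Variables (P : probability T R) (n1 n2 r L m : nat).
Variables (tau Am Xm lam th delta : R) (Xs : 'M[R]_(n1, n2)).
Variables (S : T -> {set 'I_n1 * 'I_n2}) (Y Xhat : T -> 'M[R]_(n1, n2)).
Variables (DQ : 'M[R]_(n1, r)) (AQ : 'M[R]_(r, n2)).
Hypotheses (tau0 : 0 < tau) (Xm0 : 0 < Xm) (m0 : (0 < m)%N).
Hypotheses (mn : (m <= n1 * n2)%N) (L0 : (0 < L)%N) (th_lam : 2 * th <= lam).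
Hypothesis th_kraft : (r * n2)%:R * (L%:R * expR (- th)) <= 2.
Hypothesis HXs : `|Xs| <= Xm / 2.
Hypothesis lam0 : 0 <= lam.
Let g : R := m%:R / (n1 * n2)%:R.
Hypothesis HS : bernoulli_sampling P g S.
Hypothesis HY : laplace_observations P tau Xs S Y.
Hypothesis mXhat : forall i j, measurable_fun setT (fun w => Xhat w i j).
Hypothesis est : forall w, is_estimate r L Am Xm tau lam (S w) (Y w) (Xhat w).
Hypothesis adQ : admissible L Am Xm DQ AQ.
Hypothesis delta0 : 0 <= delta.
Hypothesis deltaQ : forall i j, `|Xs i j - (DQ *m AQ) i j| <= delta.

Local Notation code := ({ffun 'I_n1 * 'I_r -> 'I_L} *
  {ffun 'I_r * 'I_n2 -> option 'I_L})%type.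

Let nn0 : (0 < n1 * n2)%N.
Proof. exact: leq_trans mn. Qed.

Let g01 : 0 <= g <= 1.
Proof.
by rewrite /g divr_ge0//= ler_pdivrMr ?ltr0n// mul1r ler_nat.
Qed.

Lemma estimate_error_le w i j : `|Xs i j - Xhat w i j| <= 3 / 2 * Xm.
Proof.
have [D [A [[_ _ [D' [A' [_ _ -> nX]]]] -> _]]] := est w.
apply: le_trans (ler_normB _ _) _.
have := le_trans (entry_le_norm Xs i j) HXs.
have := le_trans (entry_le_norm (D' *m A') i j) nX; lra.
Qed.

Lemma frobenius_error_le w : g * frobenius (Xs - Xhat w) ^+ 2 <=
  16 * (tau^-1 + Xm) ^+ 2 *
  (\sum_(c : code) tilted_weight tau Xs Am th g c *
      root_ratio S tau Xs Y (candidate Am c) w +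
   ((n1 * r)%:R * ln L%:R + 2 + lam / 2 * (l0norm AQ)%:R) +
   tau * delta / 2 * #|S w|%:R).
Proof.
apply: le_trans (ler_wpM2l _ (affinity_gap_le_sum tau0 g adQ deltaQ th_lam (est w))); last first.
  by rewrite mulr_ge0// sqr_ge0.
rewrite [X in _ <= X]mulrCA; apply: ler_wpM2l; first by case/andP: g01.
rewrite frobenius_sqrE mulr_sumr; apply: ler_sum => ij _.
rewrite !mxE; apply: sqr_error_le_affinity => //.
exact: estimate_error_le.
Qed.

Lemma measurable_frobenius_error :
  measurable_fun setT (fun w => frobenius (Xs - Xhat w) ^+ 2).
Proof.
under eq_fun do rewrite frobenius_sqrE.
apply: measurable_sum => ij; apply: measurable_funX.
under eq_fun do rewrite !mxE.
exact: measurable_funB.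
Qed.

Lemma expected_weighted_root_ratio :
  (\int[P]_w (\sum_(c : code) tilted_weight tau Xs Am th g c *
      root_ratio S tau Xs Y (candidate Am c) w)%:E <= 1)%E.
Proof.
have tw0 (c : code) : 0 <= tilted_weight tau Xs Am th g c :> R by apply: mulr_ge0; exact: expR_ge0.
under eq_integral do rewrite -sumEFin.
rewrite ge0_integral_sum//; last 2 first.
- move=> c; apply/measurable_EFinP; apply: measurable_funM => //.
  exact: measurable_root_ratio HS _ _ _ HY _.
- by move=> c w _; rewrite lee_fin mulr_ge0// root_ratio_ge0.
apply: (@le_trans _ _ (\sum_(c : code) (code_weight th c)%:E)%E); last first.
  by rewrite sumEFin lee_fin sum_code_weight_le1.
apply: lee_sum => c _; under eq_integral do rewrite EFinM.
rewrite ge0_integralZl_EFin//; last 2 first.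
- by move=> w _; rewrite lee_fin root_ratio_ge0.
- apply/measurable_EFinP; exact: measurable_root_ratio HS _ _ _ HY _.
apply: le_trans (lee_wpmul2l _ (expected_root_ratio HS HY tau0 (candidate Am c) g01)) _.
  by rewrite lee_fin.
by rewrite -EFinM lee_fin /tilted_weight -mulrA -expRD subrr expR0 mulr1.
Qed.

(** The 3 is the constant 2 of the code length plus the bound 1 on the mean of the weighted root
    ratios. The mean sample size is [g * (n1 * n2) = m], and division by the same quantity leaves
    [tau * delta / 2]. *)
Lemma oracle_risk :
  (mean_sq_error P Xs Xhat <=
   (16 * (tau^-1 + Xm) ^+ 2 *
     (((n1 * r)%:R * ln L%:R + 3 + lam / 2 * (l0norm AQ)%:R) / m%:R +
      tau * delta / 2))%:E)%E.
Proof.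
have nR : 0 < (n1 * n2)%:R :> R by rewrite ltr0n.
have mR : 0 < m%:R :> R by rewrite ltr0n.
have gg : 0 < g by rewrite divr_gt0.
set K := 16 * (tau^-1 + Xm) ^+ 2.
have K0 : 0 <= K by rewrite mulr_ge0// sqr_ge0.
pose W w := \sum_(c : code) tilted_weight tau Xs Am th g c *
      root_ratio S tau Xs Y (candidate Am c) w.
pose B := (n1 * r)%:R * ln L%:R + 2 + lam / 2 * (l0norm AQ)%:R.
have L1 : 0 <= ln L%:R :> R by rewrite ln_ge0// ler1n.
have B0 : 0 <= B by rewrite !addr_ge0// !mulr_ge0// invr_ge0.
have W0 w : 0 <= W w.
  apply: sumr_ge0 => c _; apply: mulr_ge0; last exact: root_ratio_ge0.
  by apply: mulr_ge0; exact: expR_ge0.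
have mW : measurable_fun setT W.
  apply: measurable_sum => c; apply: measurable_funM => //.
  exact: measurable_root_ratio HS _ _ _ HY _.
have mC : measurable_fun setT (fun w => #|S w|%:R : R).
  exact: (@measurable_sampling _ _ _ _ _ _ _ _ HS (fun s _ => #|s|%:R)).
have mWBC : measurable_fun setT (fun w => (W w)%:E + B%:E +
    (tau * delta / 2)%:E * (#|S w|%:R)%:E)%E.
  apply: emeasurable_funD; last by apply/measurable_funeM/measurable_EFinP.
  by apply: emeasurable_funD => //; exact/measurable_EFinP.
have td0 : 0 <= tau * delta / 2 by rewrite divr_ge0// mulr_ge0// ltW.
have I1 : (g%:E * \int[P]_w (frobenius (Xs - Xhat w) ^+ 2)%:E <=
    (K * (1 + B + tau * delta / 2 * m%:R))%:E)%E.
  rewrite -ge0_integralZl_EFin//; last 3 first.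
  - by move=> w _; rewrite lee_fin sqr_ge0.
  - by apply/measurable_EFinP; exact: measurable_frobenius_error.
  - exact: ltW.
  apply: (@le_trans _ _ (\int[P]_w (K%:E * ((W w)%:E + B%:E +
      (tau * delta / 2)%:E * (#|S w|%:R)%:E)))%E).
    apply: ge0_le_integral => //.
    - by move=> w _; rewrite -EFinM lee_fin mulr_ge0 ?sqr_ge0// ltW.
    - apply/measurable_funeM/measurable_EFinP; exact: measurable_frobenius_error.
    - exact/measurable_funeM.
    - move=> w _; rewrite -EFinM (_ : (K%:E * _)%E =
        (K * (W w + B + tau * delta / 2 * #|S w|%:R))%:E)// lee_fin.
      exact: frobenius_error_le.
  have eW0 w : (0 <= (W w)%:E)%E by rewrite lee_fin.
  have eB0 : (0 <= B%:E)%E by rewrite lee_fin.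
  have eWB0 w : (0 <= (W w)%:E + B%:E)%E by exact: adde_ge0.
  have eC0 w : (0 <= (#|S w|%:R)%:E :> \bar R)%E by rewrite lee_fin.
  have etC0 w : (0 <= (tau * delta / 2)%:E * (#|S w|%:R)%:E)%E.
    by apply: mule_ge0; rewrite ?lee_fin.
  have meW : measurable_fun setT (fun w => (W w)%:E) by exact/measurable_EFinP.
  have meC : measurable_fun setT (fun w => (#|S w|%:R)%:E : \bar R).
    exact/measurable_EFinP.
  have mWB : measurable_fun setT (fun w => (W w)%:E + B%:E)%E.
    exact: emeasurable_funD.
  rewrite ge0_integralZl_EFin//; last by move=> w _; exact: adde_ge0.
  rewrite [X in (_ <= X)%E]EFinM; apply: lee_wpmul2l; first by rewrite lee_fin.
  rewrite ge0_integralD//; last exact: measurable_funeM.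
  rewrite ge0_integralD// ge0_integralZl_EFin//.
  have -> : (\int[P]_w B%:E = B%:E)%E.
    rewrite integral_cst// -[RHS]mule1; congr (_ * _)%E.
    exact: probability_setT.
  rewrite (expected_sample_size HS).
  rewrite /g divfK ?gt_eqF// !EFinD EFinM leeD2r// leeD2r//.
  exact: expected_weighted_root_ratio.
rewrite /mean_sq_error unlock inver gt_eqF// lee_pdivrMr//.
have ginv : (g^-1 * g = 1)%R by rewrite mulVf// gt_eqF.
set E := (X in (X <= _)%E).
have -> : E = ((g^-1)%:E * (g%:E * E))%E by rewrite muleA -EFinM ginv mul1e.
apply: le_trans (lee_wpmul2l _ I1) _; first by rewrite lee_fin invr_ge0 ltW.
rewrite -!EFinM lee_fin le_eqVlt; apply/orP; left; apply/eqP.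
rewrite /B /g; move: (gt_eqF nR) (gt_eqF mR).
by move: ((n1 * n2)%:R : R) (m%:R : R) => nn mm hn hm; field; rewrite hn hm.
Qed.

End risk.

(** * Discretization *)

Section discretization.
Context {R : realType}.

Lemma nearest_level L (b x : R) : (1 < L)%N -> 0 < b -> `|x| <= b ->
  exists2 k : nat, (k < L)%N & `|x - level L b k| <= b / L.-1%:R.
Proof.
move=> L1 b0 xb.
have l0 : 0 < L.-1%:R :> R by rewrite ltr0n -subn1 subn_gt0.
have LE : L%:R = L.-1%:R + 1 :> R by rewrite -{1}(prednK (ltnW L1)) -natr1.
move: xb; rewrite ler_norml => /andP[x1 x2].
(* The position of [x] in units of the spacing, shifted by 1/2 so that truncation rounds to the
   nearest level. *)
pose z := (x + b) * L.-1%:R / (2 * b) + 2^-1.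
have z0 : 2^-1 <= z.
  rewrite lerDr divr_ge0// ?mulr_ge0// ?(ltW b0) ?(ltW l0)//; lra.
have zL : z <= L.-1%:R + 2^-1.
  rewrite lerD2r ler_pdivrMr ?mulr_gt0// [X in _ <= X]mulrC.
  by apply: ler_wpM2r; [exact: ltW | lra].
have zz : 0 <= z by lra.
have /andP[k1 k2] := truncn_itv zz.
exists (Num.truncn z).
  rewrite -(ltr_nat R) LE; apply: le_lt_trans k1 _; lra.
have -> : x - level L b (Num.truncn z) =
    2 * b / L.-1%:R * (z - 2^-1 - (Num.truncn z)%:R).
  by rewrite /level /z; field; rewrite !gt_eqF.
have bl : 0 <= 2 * b / L.-1%:R by rewrite divr_ge0 ?mulr_ge0 ?(ltW b0) ?(ltW l0).
rewrite normrM (ger0_norm bl).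
rewrite [X in _ <= X](_ : _ = 2 * b / L.-1%:R * 2^-1); last by field; rewrite gt_eqF.
apply: ler_wpM2l => //; rewrite ler_norml.
by move: k2; rewrite -natr1 => k2; apply/andP; split; lra.
Qed.

Lemma level_norm_le L (b : R) k : (k < L)%N -> 0 < b -> `|level L b k| <= b.
Proof.
move=> kL b0; rewrite /level ler_norml.
have [L1|L1] := leqP L 1.
  (* With a single level the division by [L.-1 = 0] gives 0, and that level is [- b]. *)
  have -> : L.-1 = 0%N by case: L L1 {kL} => [|[]].
  by rewrite invr0 mulr0 addr0; apply/andP; split; lra.
have l0 : 0 < L.-1%:R :> R by rewrite ltr0n -subn1 subn_gt0.
have q0 : 0 <= k%:R / L.-1%:R :> R by rewrite divr_ge0.
have q1 : k%:R / L.-1%:R <= 1 :> R.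
  by rewrite ler_pdivrMr// mul1r ler_nat -ltnS prednK// (leq_ltn_trans _ kL).
by rewrite -mulrA; apply/andP; split; nra.
Qed.

(** [K] holds the entries of [A] that are kept. A dropped entry costs at most its absolute value
    because the entries of [D] are at most 1; a kept one costs b / (L - 1) for rounding [A] and as
    much for rounding [D]. *)
Lemma exists_quantization (n1 n2 r L : nat) (D : 'M[R]_(n1, r)) (A : 'M[R]_(r, n2))
    (b e : R) (K : {set 'I_r * 'I_n2}) :
  (1 < L)%N -> 0 < b -> `|D| <= 1 -> `|A| <= b ->
  (forall j, \sum_(k | (k, j) \notin K) `|A k j| <= e) ->
  exists (DQ : 'M[R]_(n1, r)) (AQ : 'M[R]_(r, n2)),
    [/\ Dclass L DQ, Aclass L b AQ, (l0norm AQ <= #|K|)%N &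
      forall i j, `|(D *m A) i j - (DQ *m AQ) i j| <=
        e + 2 * r%:R * b / L.-1%:R].
Proof.
move=> L1 b0 D1 Ab Ke.
have Dij i k : `|D i k| <= 1 := le_trans (entry_le_norm D i k) D1.
have Aij k j : `|A k j| <= b := le_trans (entry_le_norm A k j) Ab.
have /choice[d Hd] : forall ik : 'I_n1 * 'I_r, exists x : R,
    levels L 1 x /\ `|D ik.1 ik.2 - x| <= 1 / L.-1%:R.
  move=> ik; have [k kL Hk] := nearest_level L1 ltr01 (Dij ik.1 ik.2).
  by exists (level L 1 k); split => //; exists k.
have /choice[c Hc] : forall kj : 'I_r * 'I_n2, exists x : R,
    [/\ levels L b x, `|A kj.1 kj.2 - x| <= b / L.-1%:R & `|x| <= b].
  move=> kj; have [k kL Hk] := nearest_level L1 b0 (Aij kj.1 kj.2).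
  exists (level L b k); split => //; first by exists k.
  exact: level_norm_le.
exists (\matrix_(i, k) d (i, k)).
exists (\matrix_(k, j) if (k, j) \in K then c (k, j) else 0).
have l0 : 0 < L.-1%:R :> R by rewrite ltr0n -subn1 subn_gt0.
have bl0 : 0 <= b / L.-1%:R by rewrite divr_ge0// ltW.
split.
- by move=> i k; rewrite mxE; have [] := Hd (i, k).
- move=> k j; rewrite mxE; case: ifP => _; last by left.
  by right; have [] := Hc (k, j).
- apply: subset_leq_card; apply/fintype.subsetP => -[k j].
  by rewrite !inE mxE /=; case: ifP => //; rewrite eqxx.
move=> i j; rewrite !mxE -sumrB.
apply: (@le_trans _ _ (\sum_(k < r) ((if (k, j) \in K then 0 else `|A k j|) +
    2 * b / L.-1%:R))).
  apply: le_trans (ler_norm_sum _ _ _) _; apply: ler_sum => k _; rewrite !mxE.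
  have [_ d1] := Hd (i, k); have [_ c1 c2] := Hc (k, j).
  case: ifPn => kK.
    rewrite add0r.
    have -> : D i k * A k j - d (i, k) * c (k, j) =
      D i k * (A k j - c (k, j)) + (D i k - d (i, k)) * c (k, j) by ring.
    apply: le_trans (ler_normD _ _) _; rewrite !normrM.
    have h1 := ler_pM (normr_ge0 _) (normr_ge0 _) (Dij i k) c1.
    have h2 := ler_pM (normr_ge0 _) (normr_ge0 _) d1 c2.
    apply: le_trans (lerD h1 h2) _.
    by rewrite le_eqVlt; apply/orP; left; apply/eqP; field; rewrite gt_eqF.
  rewrite mulr0 subr0 normrM.
  have h1 := ler_pM (normr_ge0 _) (normr_ge0 _) (Dij i k) (lexx `|A k j|).
  by apply: le_trans h1 _; rewrite mul1r lerDl -mulrA mulr_ge0.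
rewrite big_split /= sumr_const card_ord.
rewrite (_ : \sum_(k < r) _ = \sum_(k | (k, j) \notin K) `|A k j|); last first.
  by rewrite [RHS]big_mkcond; apply: eq_bigr => k _; case: ifP.
apply: lerD => //.
rewrite [X in X <= _](_ : _ = 2 * r%:R * b / L.-1%:R)//.
by rewrite -[LHS]mulr_natl; ring.
Qed.

End discretization.

(** * Consequences of the choice of beta and of the number of levels *)

Section parameters.
Context {R : realType}.
Variables (n1 n2 r : nat) (Am Xm : R).
Hypotheses (N4 : (4 <= n1 * n2)%N) (r0 : (0 < r)%N) (rn2 : (r <= n2)%N).
Hypotheses (Am0 : 0 < Am) (AmN : Am <= (maxn n1 n2)%:R) (Xm1 : 1 <= Xm).
Let N : nat := maxn n1 n2.
Let beta := beta_par n1 n2 r Am Xm.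
Let L := Llev n1 n2 beta.
Let q := 8 * r%:R * Am / Xm.

Lemma dim_ge2 : (2 <= N)%N.
Proof.
rewrite leqNgt; apply/negP => N1.
have n11 : (n1 <= 1)%N by exact: leq_trans (leq_maxl _ _) N1.
have n21 : (n2 <= 1)%N by exact: leq_trans (leq_maxr _ _) N1.
by have := leq_trans N4 (leq_mul n11 n21).
Qed.

Lemma ln2_ge_half : 2^-1 <= ln 2 :> R.
Proof.
have := expR_ge1Dx (- ln (2 : R)); rewrite expRN lnK ?posrE//; lra.
Qed.

Let NR : 2 <= N%:R :> R.
Proof. by rewrite (ler_nat R 2) dim_ge2. Qed.

Let N0 : 0 < N%:R :> R.
Proof. exact: lt_le_trans NR. Qed.

Lemma ln_dim_ge : ln 2 <= ln N%:R :> R.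
Proof. by rewrite ler_ln ?posrE. Qed.

Let lN0 : 0 < ln N%:R :> R.
Proof. by apply: lt_le_trans ln_dim_ge; apply: lt_le_trans ln2_ge_half. Qed.

Let Xm0 : 0 < Xm.
Proof. exact: lt_le_trans Xm1. Qed.

Let rR : 1 <= r%:R :> R.
Proof. by rewrite ler1n. Qed.

Let q0 : 0 < q.
Proof. by rewrite /q divr_gt0// !mulr_gt0// ltr0n. Qed.

Lemma beta_ge1 : 1 <= beta.
Proof. by rewrite /beta /beta_par le_max lexx. Qed.

(** The purpose of the second branch of [beta]: N^beta is at least 8 r Am N / Xm, enough levels to
    bring the rounding error of the product down to order Xm / N. *)
Lemma beta_ln_ge : ln (N%:R * q) <= beta * ln N%:R.
Proof.
rewrite lnM ?posrE// -ler_pdivrMr// mulrDl divff ?gt_eqF//.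
by rewrite /beta /beta_par le_max lexx orbT.
Qed.

(** From r <= n2 <= N, Am <= N, Xm >= 1 and 8 <= N^3 one gets q <= N^5. Thus [beta] can be absorbed
    into a numerical constant. *)
Lemma beta_le6 : beta <= 6.
Proof.
rewrite /beta /beta_par ge_max; apply/andP; split; first by lra.
rewrite -/N -/q; apply: (@le_trans _ _ (1 + 5)); last by lra.
rewrite lerD2l.
rewrite ler_pdivrMr// mulr_natl -lnXn// ler_ln ?posrE ?exprn_gt0//.
rewrite /q ler_pdivrMr//.
have rN : r%:R <= N%:R :> R by rewrite ler_nat (leq_trans rn2)// leq_maxr.
have N8 : 8 <= N%:R ^+ 3 :> R.
  have N2 : 4 <= N%:R * N%:R :> R by move: NR; nra.
  by rewrite !exprS expr0 mulr1; move: NR N2; nra.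
have rA : r%:R * Am <= N%:R * N%:R by rewrite ler_pM// ltW.
rewrite -mulrA; apply: (@le_trans _ _ (N%:R ^+ 3 * (N%:R * N%:R))).
  by rewrite ler_pM// mulr_ge0// ltW.
rewrite -[X in X <= _]mulr1 (_ : N%:R ^+ 3 * _ = N%:R ^+ 5); last by ring.
by rewrite ler_wpM2l// exprn_ge0// ltW.
Qed.

Let beta0 : 0 < beta.
Proof. exact: lt_le_trans beta_ge1. Qed.

Let ln2_gt0 : 0 < ln 2 :> R.
Proof. by apply: lt_le_trans ln2_ge_half. Qed.

(** Rounding the exponent of 2 up to an integer at most doubles N^beta. *)
Lemma ln_levels_itv : beta * ln N%:R <= ln L%:R <= beta * ln N%:R + ln 2.
Proof.
rewrite /L /Llev -/N natrX lnXn//; set x := _ / ln 2.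
have xE : x = beta * ln N%:R / ln 2 by rewrite /x ln_powR.
have x0 : 0 <= x by rewrite xE divr_ge0// ?mulr_ge0// ltW.
have c0 : 0 <= Num.ceil x by rewrite ceil_ge0 (lt_le_trans _ x0).
have -> : ln 2 *+ `|Num.ceil x|%N = (Num.ceil x)%:~R * ln 2 :> R.
  by rewrite -[LHS]mulr_natl natr_absz ger0_norm.
have /andP[h1 h2] := ceil_itv x.
have bE : beta * ln N%:R = x * ln 2 by rewrite xE divfK// gt_eqF.
rewrite bE; apply/andP; split; first by apply: ler_wpM2r => //; exact: ltW.
rewrite -[X in _ <= _ + X]mul1r -mulrDl; apply: ler_wpM2r; first exact: ltW.
by rewrite -lerBlDr -[1]/(1%:~R) -intrB ltW.
Qed.

Lemma levels_gt0 : (0 < L)%N.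
Proof. by rewrite /L /Llev expn_gt0. Qed.

Let LR0 : 0 < L%:R :> R.
Proof. by rewrite ltr0n levels_gt0. Qed.

Lemma levels_ge2 : (1 < L)%N.
Proof.
rewrite -(ltr_nat R) -ltr_ln ?posrE// ln1.
have /andP[h _] := ln_levels_itv.
by apply: lt_le_trans h; exact: mulr_gt0.
Qed.

Lemma ln_levels_le : ln L%:R <= 7 * ln N%:R :> R.
Proof.
have /andP[_ h] := ln_levels_itv.
have := ler_wpM2r (ltW lN0) beta_le6; have := ln_dim_ge; lra.
Qed.

Lemma levels_ge_scaled : N%:R * q <= L%:R.
Proof.
have Nq0 : 0 < N%:R * q by exact: mulr_gt0.
rewrite -ler_ln ?posrE//.
have /andP[h _] := ln_levels_itv; exact: le_trans beta_ln_ge h.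
Qed.

(** In the cost (beta + 2) ln N of a nonzero entry, beta ln N pays for its level, as L <= 2 N^beta,
    and 2 ln N for its position, as r n2 <= N^2. *)
Lemma levels_kraft :
  (r * n2)%:R * (L%:R * expR (- ((beta + 2) * ln N%:R))) <= 2.
Proof.
have /andP[_ h] := ln_levels_itv.
have h2 : L%:R * expR (- ((beta + 2) * ln N%:R)) <= 2 / N%:R ^+ 2.
  rewrite -[L%:R](@lnK R) ?posrE// -expRD.
  apply: (@le_trans _ _ (expR (ln 2 - ln (N%:R ^+ 2)))).
    rewrite ler_expR lnXn// -[ln _ *+ 2]mulr_natl; lra.
  by rewrite expRB !lnK ?posrE ?exprn_gt0.
apply: (@le_trans _ _ (N%:R ^+ 2 * (2 / N%:R ^+ 2))).
  have LE0 : 0 <= L%:R * expR (- ((beta + 2) * ln N%:R)) by rewrite mulr_ge0 ?expR_ge0// ltW.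
  apply: ler_pM => //.
  rewrite natrM expr2; apply: ler_pM; rewrite ?ler_nat//.
    exact: leq_trans rn2 (leq_maxr _ _).
  exact: leq_maxr.
by rewrite mulrCA divff ?mulr1// expf_neq0// gt_eqF.
Qed.

(** L - 1 >= L / 2 and L >= N q; the 8 in [q] is what yields the factor 1/2 on the right. *)
Lemma quantization_error_le :
  2 * r%:R * Am / L.-1%:R <= Xm / (2 * N%:R).
Proof.
have L2 : L%:R / 2 <= L.-1%:R :> R.
  have LE : L%:R = L.-1%:R + 1 :> R by rewrite -{1}(prednK levels_gt0) -natr1.
  have L2 : 2 <= L%:R :> R by rewrite (ler_nat R 2) levels_ge2.
  rewrite LE in L2 *; lra.
have l0 : 0 < L.-1%:R :> R by apply: lt_le_trans L2; rewrite divr_gt0.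
rewrite ler_pdivrMr//.
apply: (@le_trans _ _ (Xm / (2 * N%:R) * (N%:R * q / 2))); last first.
  apply: ler_wpM2l; first by rewrite divr_ge0 ?mulr_ge0// ltW.
  apply: le_trans L2; rewrite ler_wpM2r// levels_ge_scaled//.
by rewrite le_eqVlt; apply/orP; left; apply/eqP; rewrite /q; field; rewrite !gt_eqF.
Qed.

End parameters.

(** * Truncation in weak lp balls *)

Section weak_lp_truncation.
Context {R : realType}.

Lemma powR_expR (x a : R) : 0 < x -> x `^ a = expR (a * ln x).
Proof. by move=> x0; rewrite /powR gt_eqF. Qed.

Lemma sum_powR_tail_le (s : R) (k n : nat) : 2 <= s -> (0 < k)%N ->
  \sum_(0 <= j < n) (k + j).+1%:R `^ (- s) <=
  k%:R `^ (2 - s) * (k%:R^-1 - (k + n)%:R^-1).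
Proof.
move=> s2 k0; elim: n => [|n IH].
  by rewrite big_geq// addn0 subrr mulr0.
(* (i + 1)^-s <= k^(2 - s) / (i (i + 1)) for i >= k, and the right side telescopes. *)
rewrite big_nat_recr//=; apply: (@le_trans _ _
    (k%:R `^ (2 - s) * (k%:R^-1 - (k + n)%:R^-1) +
    k%:R `^ (2 - s) * ((k + n)%:R^-1 - (k + n.+1)%:R^-1))); last first.
  by rewrite -mulrDr addrA subrK.
apply: lerD => //.
set i := (k + n)%N; rewrite addnS -/i.
have i0 : 0 < i%:R :> R by rewrite ltr0n addn_gt0 k0.
have i1 : 0 < i.+1%:R :> R by rewrite ltr0n.
have iE : i.+1%:R = i%:R + 1 :> R by rewrite natr1.
have -> : i.+1%:R `^ (- s) = i.+1%:R `^ (2 - s) * i.+1%:R ^- 2 :> R.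
  rewrite -[X in _ * X](_ : i.+1%:R `^ (- 2) = _).
    rewrite -powRD; last by rewrite (gt_eqF i1) implybT.
    by congr (_ `^ _); ring.
  by rewrite powRN powR_mulrn// ltW.
apply: ler_pM; rewrite ?powR_ge0 ?invr_ge0 ?exprn_ge0//.
  rewrite -opprB !powRN lef_pV2 ?posrE ?powR_gt0 ?ltr0n//.
  rewrite ge0_ler_powR ?nnegrE// ?subr_ge0// ler_nat.
  by rewrite (leq_trans (leq_addr n k))// leqnSn.
rewrite iE in i1 *.
have -> : i%:R^-1 - (i%:R + 1)^-1 = (i%:R * (i%:R + 1))^-1 :> R.
  by field; rewrite !gt_eqF.
rewrite lef_pV2 ?posrE ?mulr_gt0 ?exprn_gt0//.
by rewrite expr2 ler_pM2r// lerDl.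
Qed.

(* A bound on the sum of i^-s over i > k. *)
Definition powR_tail (s : R) (k : nat) : R :=
  if k is 0%N then 2 else k%:R `^ (1 - s).

Lemma powR_tail_ge0 s k : 0 <= powR_tail s k.
Proof. by case: k => [|k] /=; rewrite ?ler0n ?powR_ge0. Qed.

Lemma sum_powR_le_tail (s : R) (k n : nat) : 2 <= s ->
  \sum_(0 <= j < n) (k + j).+1%:R `^ (- s) <= powR_tail s k.
Proof.
have pos (l o : nat) : (0 < l)%N -> 2 <= s ->
    \sum_(0 <= j < o) (l + j).+1%:R `^ (- s) <= l%:R `^ (1 - s).
  move=> l0 s2; apply: le_trans (sum_powR_tail_le o s2 l0) _.
  have lR : 0 < l%:R :> R by rewrite ltr0n.
  apply: (@le_trans _ _ (l%:R `^ (2 - s) * l%:R^-1)).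
    by rewrite ler_wpM2l ?powR_ge0// gerBl invr_ge0.
  rewrite -(powR_inv1 (ltW lR)) -powRD; last by rewrite (gt_eqF lR) implybT.
  have -> : 2 - s + -1 = 1 - s by ring.
  exact: lexx.
move=> s2; case: k => [|k]; last exact: pos.
case: n => [|n]; first by rewrite big_geq//= ler0n.
(* The value 2 at k = 0: the first term is 1, and the others sum to at most 1 by the case k = 1. *)
rewrite big_nat_recl//= powR1.
have := pos 1%N n isT s2; rewrite powR1 => h.
rewrite (_ : 2 = 1 + 1)// lerD2l; apply: le_trans h.
by rewrite le_eqVlt; apply/orP; left.
Qed.

Lemma weak_lp_truncation (r : nat) (x : 'cV[R]_r) (p rad : R) (k : nat) :
  0 < p -> p <= 2^-1 -> 0 <= rad -> weak_lp_ball p rad x ->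
  exists2 K : {set 'I_r}, (#|K| <= k)%N &
    \sum_(i | i \notin K) `|x i 0| <= rad * powR_tail p^-1 k.
Proof.
move=> p0 p2 rad0 wx; set f := fun i => `|x i 0|.
have s2 : 2 <= p^-1 by rewrite -[2]invrK lef_pV2 ?posrE.
(* Indices are sorted rather than values, so that the k largest entries form a set of positions. *)
pose t := sort (relpre f >=%O) (enum 'I_r).
have tE : sort >=%O [seq f i | i <- enum 'I_r] = map f t by rewrite sort_map.
have wt i : (i < r)%N -> nth 0 (map f t) i <= rad * i.+1%:R `^ (- p^-1).
  by move=> ir; rewrite -tE; exact: wx.
have tp : perm_eq t (enum 'I_r) by rewrite perm_sort.
have tu : uniq t by rewrite (perm_uniq tp) enum_uniq.
have tsz : size t = r by rewrite (perm_size tp) size_enum_ord.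
exists [set i in take k t]%SET.
  by rewrite cardsE (leq_trans (card_size _))// size_take_min geq_minl.
have -> : \sum_(i | i \notin [set i in take k t]%SET) f i = \sum_(i <- drop k t) f i.
  transitivity (\sum_(i <- enum 'I_r | i \notin [set i in take k t]%SET) f i).
    by rewrite big_enum_cond; apply: eq_bigl.
  rewrite -(perm_big _ tp) /= -{1}(cat_take_drop k t) big_cat /=.
  rewrite big1_seq ?add0r; last by move=> i; rewrite inE => /andP[/negP].
  rewrite -big_filter; congr bigop; apply/all_filterP/allP => i it.
  rewrite inE; apply/negP => it'.
  by move: tu; rewrite -(cat_take_drop k t) cat_uniq => /and3P[_ /hasPn/(_ i it)/negP].
(* Indexing [t] needs a default ordinal, hence a positive dimension; in dimension 0 the sum is
   empty. *)
move: tsz wt; clear tu tp tE wx; move: f t; case: r x => [|r] x f t tsz wt.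
  by rewrite (size0nil tsz) big_nil mulr_ge0// powR_tail_ge0.
rewrite (big_nth ord0) size_drop tsz.
apply: (@le_trans _ _ (\sum_(0 <= j < r.+1 - k) rad * (k + j).+1%:R `^ (- p^-1))).
  apply: ler_sum_nat => j /andP[_ jr].
  have kj : (k + j < r.+1)%N by rewrite -ltn_subRL.
  have := wt _ kj; rewrite (nth_map ord0) ?tsz// => h.
  by rewrite nth_drop.
by rewrite -mulr_sumr ler_wpM2l// sum_powR_le_tail.
Qed.

Lemma weak_lp_truncation_mx (r n : nat) (A : 'M[R]_(r, n)) (p rad : R) (k : nat) :
  0 < p -> p <= 2^-1 -> 0 <= rad -> (forall j, weak_lp_ball p rad (col j A)) ->
  exists2 K : {set 'I_r * 'I_n}, (#|K| <= n * k)%N &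
    forall j, \sum_(i | (i, j) \notin K) `|A i j| <= rad * powR_tail p^-1 k.
Proof.
move=> p0 p2 rad0 wA.
have /choice[c Hc] : forall j, exists K : {set 'I_r}, (#|K| <= k)%N /\
    \sum_(i | i \notin K) `|A i j| <= rad * powR_tail p^-1 k.
  move=> j; have [K Kk HK] := weak_lp_truncation k p0 p2 rad0 (wA j).
  exists K; split => //; apply: le_trans HK.
  by rewrite le_eqVlt; apply/orP; left; apply/eqP; apply: eq_bigr => i _; rewrite mxE.
exists [set ij : 'I_r * 'I_n | ij.1 \in c ij.2]%SET.
  rewrite -sum1_card big_mkcond /=.
  rewrite (eq_bigr (fun ij => (ij.1 \in c ij.2 : nat))); last first.
    by move=> ij _; rewrite inE; case: ifP.
  rewrite -(pair_bigA _ (fun i j => (i \in c j : nat))) exchange_big /=.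
  rewrite -[X in (_ <= X * _)%N]card_ord -sum_nat_const.
  apply: leq_sum => j _; have [ck _] := Hc j; apply: leq_trans ck.
  rewrite -sum1_card [X in (_ <= X)%N]big_mkcond /=; apply: eq_leq; apply: eq_bigr => i _.
  by case: ifP.
move=> j; have [_ h] := Hc j; apply: le_trans h.
rewrite le_eqVlt; apply/orP; left; apply/eqP; apply: eq_bigl => i.
by rewrite inE.
Qed.

(** One [k] balances the two costs of truncation, the number n k / m of kept entries and the tail
    k^(1 - 1/p): at k = (m / n)^p both equal (n / m)^(1 - p), and the exponent of the rate is 1 - p.
    The integer above (m / n)^p is at most twice as large; for n > m the rate is at least 1 and k =
    0 suffices. *)
Lemma truncation_level (n m : nat) (p : R) :
  (0 < n)%N -> (0 < m)%N -> 0 < p -> p <= 2^-1 ->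
  let rate := (n%:R / m%:R) `^ ((p^-1 - 1) / (p^-1 - 1 + 1)) in
  exists2 k : nat, n%:R * k%:R <= 2 * rate * m%:R & powR_tail p^-1 k <= 2 * rate.
Proof.
move=> n0 m0 p0 p2 /=.
have nR : 0 < n%:R :> R by rewrite ltr0n.
have mR : 0 < m%:R :> R by rewrite ltr0n.
have -> : (p^-1 - 1) / (p^-1 - 1 + 1) = 1 - p.
  by rewrite subrK invrK mulrBl mulVf ?gt_eqF// mul1r.
have nm0 : 0 < n%:R / m%:R :> R by rewrite divr_gt0.
(* k is about (m / n)^p, or 0 when this is below 1. *)
rewrite powR_expR//; set l := ln (n%:R / m%:R).
have [nm|nm] := leqP n m; last first.
  exists 0%N; first by rewrite mulr0 !mulr_ge0// expR_ge0.
  rewrite /= ler_peMr// -[X in X <= _]expR0 ler_expR mulr_ge0//; first by lra.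
  by rewrite ln_ge0// ler_pdivlMr// mul1r ler_nat ltnW.
have l0 : l <= 0 by rewrite ln_le0// ler_pdivrMr// mul1r ler_nat.
pose c := expR (- (p * l)).
have c1 : 1 <= c by rewrite -[X in X <= _]expR0 ler_expR; nra.
have c0 : 0 < c by exact: lt_le_trans c1.
have /andP[k1 k2] := truncn_itv (ltW c0).
have rE : expR ((1 - p) * l) = n%:R / m%:R * c.
  by rewrite -[n%:R / m%:R](@lnK R) ?posrE// -expRD -/l; congr expR; ring.
exists (Num.truncn c).+1.
  rewrite rE (_ : 2 * _ * _ = n%:R * (2 * c)); last by field; rewrite gt_eqF.
  by rewrite ler_wpM2l// -natr1; lra.
rewrite /powR_tail powR_expR ?ltr0n//.
apply: (@le_trans _ _ (expR ((1 - p) * l))); last by have := expR_ge0 ((1 - p) * l); lra.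
rewrite ler_expR.
have lk : - (p * l) <= ln (Num.truncn c).+1%:R.
  by rewrite -[X in X <= _](@expRK R) ler_ln ?posrE ?ltr0n// ltW.
have -> : (1 - p) * l = (1 - p^-1) * (- (p * l)) by field; rewrite gt_eqF.
rewrite ler_wnM2l// subr_le0 invf_ge1//; lra.
Qed.

End weak_lp_truncation.

(** * Risk bounds for the prescribed parameters *)

Section sparse_oracle.
Context {R : realType} {d : measure_display} {T : measurableType d}.
Variables (P : probability T R) (n1 n2 r m : nat).
Variables (Ds : 'M[R]_(n1, r)) (As : 'M[R]_(r, n2)) (Xs : 'M[R]_(n1, n2)).
Variables (Am Xm tau t0 : R).
Variables (S : T -> {set 'I_n1 * 'I_n2}) (Y Xhat : T -> 'M[R]_(n1, n2)).
Let N := maxn n1 n2.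
Let beta := beta_par n1 n2 r Am Xm.
Let lambda := lambda_par n1 n2 tau Xm beta.
Let L := Llev n1 n2 beta.
Hypotheses (XsE : Xs = Ds *m As) (rn2 : (r <= n2)%N).
Hypotheses (Ds1 : `|Ds| <= 1) (AsA : `|As| <= Am) (XsX : `|Xs| <= Xm / 2).
Hypotheses (Am0 : 0 < Am) (AmN : Am <= N%:R) (Xm1 : 1 <= Xm).
Hypotheses (m4 : (4 <= m)%N) (mn : (m <= n1 * n2)%N).
Hypotheses (tau0 : 0 < tau) (t00 : 0 < t0) (t0X : t0 <= tau * Xm).
Hypothesis HS : bernoulli_sampling P (m%:R / (n1 * n2)%:R) S.
Hypothesis HY : laplace_observations P tau Xs S Y.
Hypothesis mXhat : forall i j, measurable_fun setT (fun w => Xhat w i j).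
Hypothesis est : forall w, is_estimate r L Am Xm tau lambda (S w) (Y w) (Xhat w).

Let n4 : (4 <= n1 * n2)%N := leq_trans m4 mn.

Let Xm0 : 0 < Xm.
Proof. exact: lt_le_trans Xm1. Qed.

Let nR : 0 < (n1 * n2)%:R :> R.
Proof. by rewrite ltr0n (leq_trans _ n4). Qed.

(** Serves the cases treated without the oracle inequality: rank 0, and a truncation error too large
    for the class. *)
Lemma mean_sq_error_le_unif c : 0 <= c ->
  (forall w i j, `|Xs i j - Xhat w i j| <= c) ->
  (mean_sq_error P Xs Xhat <= (c ^+ 2)%:E)%E.
Proof.
move=> c0 Hc; rewrite /mean_sq_error unlock inver gt_eqF// lee_pdivrMr//.
apply: (@le_trans _ _ (\int[P]_w (c ^+ 2 * (n1 * n2)%:R)%:E)%E).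
  apply: ge0_le_integral => //.
  - by move=> w _; rewrite lee_fin sqr_ge0.
  - by apply/measurable_EFinP; exact: measurable_frobenius_error.
  - move=> w _; rewrite lee_fin frobenius_sqrE.
    apply: (@le_trans _ _ (\sum_(ij : 'I_n1 * 'I_n2) c ^+ 2)).
      apply: ler_sum => ij _; rewrite !mxE -real_normK ?num_real//.
      by rewrite lerXn2r ?nnegrE.
    by rewrite sumr_const card_prod !card_ord mulr_natr.
rewrite integral_cst// EFinM -[X in (_ <= X)%E]mule1.
rewrite le_eqVlt; apply/orP; left; apply/eqP; congr (_ * _)%E.
exact: probability_setT.
Qed.

Lemma mean_sq_error_le_trivial :
  (mean_sq_error P Xs Xhat <= ((3 / 2 * Xm) ^+ 2)%:E)%E.
Proof.
apply: mean_sq_error_le_unif; first by rewrite mulr_ge0// ltW.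
move=> w i j; exact: (estimate_error_le XsX est).
Qed.

Lemma mean_sq_error_rank0 : r = 0%N -> (mean_sq_error P Xs Xhat <= 0)%E.
Proof.
move=> r0; suff : (mean_sq_error P Xs Xhat <= ((0 : R) ^+ 2)%:E)%E by rewrite expr0n.
apply: mean_sq_error_le_unif => // w i j.
have [D [A [_ -> _]]] := est w; rewrite XsE !mxE !big1 ?subrr ?normr0//.
  by move=> [k kr]; exfalso; rewrite r0 in kr.
by move=> [k kr]; exfalso; rewrite r0 in kr.
Qed.

(** The condition e <= Xm / 4 makes the rounded candidate admissible: Xm / 2 + Xm / 4 + Xm / (2 N)
    <= Xm as N >= 2. In the constant, 21 = 7 + 6 + 8 collects ln L, the additive 3 and the part of
    lambda free of tau; 12 covers the 32/3 from C_D and the 1/2 from rounding. *)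
Lemma sparse_oracle_risk (K : {set 'I_r * 'I_n2}) (e : R) :
  (0 < r)%N -> 0 <= e -> e <= Xm / 4 ->
  (forall j, \sum_(k | (k, j) \notin K) `|As k j| <= e) ->
  (mean_sq_error P Xs Xhat <=
    (16 * (tau^-1 + Xm) ^+ 2 *
      ((21 / t0 + 12) * (tau * Xm * ln N%:R) *
          ((n1%:R * r%:R + #|K|%:R) / m%:R) + tau * e / 2))%:E)%E.
Proof.
move=> r0 e0 eX Ke.
have N2 := dim_ge2 n4; rewrite -/N in N2.
have L1 := @levels_ge2 R n1 n2 r Am Xm n4; rewrite -/beta -/L in L1.
have L0 := @levels_gt0 R n1 n2 r Am Xm; rewrite -/beta -/L in L0.
have qe := quantization_error_le n4 r0 Am0 Xm1; rewrite -/beta -/L -/N in qe.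
have kraft := levels_kraft Am Xm n4 rn2; rewrite -/beta -/L -/N in kraft.
have b6 := beta_le6 n4 r0 rn2 Am0 AmN Xm1; rewrite -/beta in b6.
have b1 := @beta_ge1 R n1 n2 r Am Xm; rewrite -/beta in b1.
have lnL := ln_levels_le n4 r0 rn2 Am0 AmN Xm1; rewrite -/beta -/L -/N in lnL.
have l2 := le_trans (@ln2_ge_half R) (@ln_dim_ge R n1 n2 n4); rewrite -/N in l2.
have NR2 : 2 <= N%:R :> R by rewrite (ler_nat R 2).
have NR : 0 < N%:R :> R by rewrite ltr0n (leq_trans _ N2).
have [DQ [AQ [DD AA szK errQ]]] := exists_quantization L1 Am0 Ds1 AsA Ke.
pose delta := e + Xm / (2 * N%:R).
have XN0 : 0 <= Xm / (2 * N%:R) by rewrite divr_ge0// ?mulr_ge0// ltW.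
have delta0 : 0 <= delta by exact: addr_ge0.
have deltaQ i j : `|Xs i j - (DQ *m AQ) i j| <= delta.
  by rewrite XsE; apply: le_trans (errQ i j) _; rewrite lerD2l.
have XN4 : Xm / (2 * N%:R) <= Xm / 4.
  apply: ler_wpM2l; first exact: ltW.
  rewrite lef_pV2 ?posrE ?mulr_gt0//.
  lra.
have nX : `|DQ *m AQ| <= Xm.
  apply: norm_le_entries; first exact: ltW.
  move=> i j; have := ler_normB (Xs i j) (Xs i j - (DQ *m AQ) i j).
  rewrite subKr => h; apply: le_trans h _.
  have := le_trans (entry_le_norm Xs i j) XsX; have := deltaQ i j.
  by rewrite /delta; lra.
have adQ : admissible L Am Xm DQ AQ by split => //; exists DQ, AQ.
set l := ln N%:R in kraft lnL l2 *.
pose th := (beta + 2) * l.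
have tX0 : 0 < tau * Xm by exact: mulr_gt0.
have l0 : 0 < l by lra.
have th0 : 0 <= th by rewrite mulr_ge0//; lra.
have lamE : lambda = 2 * (1 + 4 / 3 * (tau * Xm)) * th.
  by rewrite /lambda /lambda_par -/N -/l /th; field.
have thl : 2 * th <= lambda by rewrite lamE; nra.
have lam0 : 0 <= lambda by apply: le_trans thl; rewrite mulr_ge0.
apply: le_trans (oracle_risk tau0 Xm0 (leq_trans _ m4) mn L0 thl kraft XsX lam0
  HS HY mXhat est adQ delta0 deltaQ) _ => //.
rewrite lee_fin ler_wpM2l//; first by rewrite mulr_ge0// sqr_ge0.
have mR : 0 < m%:R :> R by rewrite ltr0n (leq_trans _ m4).
have n1R : 1 <= n1%:R :> R.
  by rewrite ler1n; case: (n1) n4.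
have rR : 1 <= r%:R :> R by rewrite ler1n.
set u := tau * Xm in tX0 lamE *.
(* Terms free of tau are multiplied by u / t0 >= 1 to acquire the factor tau Xm of the rate; this
   produces 21 / t0. *)
have u1 : 1 <= u / t0 by rewrite ler_pdivlMr// mul1r; exact: t0X.
have nr1 : 1 <= n1%:R * r%:R :> R by nra.
set a := n1%:R * r%:R in nr1 *; set z := #|K|%:R.
have szR : (l0norm AQ)%:R <= z :> R by rewrite ler_nat.
have z0 : 0 <= z by [].
have up : 0 < u / t0 by exact: divr_gt0.
set v := u / t0 in u1 up *.
have tE : u = t0 * v by rewrite /v mulrCA divff ?mulr1// gt_eqF.
have h1 : a * ln L%:R <= 7 * (v * l * a).
  apply: (@le_trans _ _ (a * (7 * l))); first by rewrite ler_wpM2l//; lra.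
  have : l * a <= v * (l * a) by rewrite ler_peMl// mulr_ge0//; lra.
  lra.
have h2 : 3 <= 6 * (v * l * a).
  have : 2^-1 <= v * l by rewrite -[X in X <= _]mul1r ler_pM.
  have : 0 <= v * l by rewrite mulr_ge0// ltW.
  nra.
have h3 : lambda / 2 * (l0norm AQ)%:R <= (8 * v + 32 / 3 * u) * l * z.
  apply: ler_pM => //; first by rewrite divr_ge0.
  rewrite lamE /th.
  have hb : (beta + 2) * l <= 8 * l by rewrite ler_pM2r//; lra.
  have hu : 0 <= 1 + 4 / 3 * u by lra.
  have hc := ler_wpM2l hu hb.
  have : l <= v * l by rewrite ler_peMl// ltW.
  lra.
(* The rounding bias is absorbed through m <= n1 n2 <= N n1 r and 1/2 <= ln N. *)
have h4 : tau * (Xm / (2 * N%:R)) / 2 <= 2^-1 * (u * l * (a / m%:R)).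
  have aN : N%:R^-1 <= a / m%:R.
    rewrite ler_pdivlMr// mulrC ler_pdivrMr//.
    apply: (@le_trans _ _ (n1 * n2)%:R); first by rewrite ler_nat.
    rewrite natrM /a -mulrA; apply: ler_pM => //.
    apply: (@le_trans _ _ N%:R); first by rewrite ler_nat leq_maxr.
    by rewrite ler_peMl// ltW.
  have -> : tau * (Xm / (2 * N%:R)) / 2 = u * (4^-1 * N%:R^-1).
    by rewrite /u; field; rewrite gt_eqF.
  rewrite [X in _ <= X](_ : _ = u * ((2^-1 * l) * (a / m%:R))); last by ring.
  apply: ler_wpM2l; first exact: ltW.
  by apply: ler_pM => //; lra.
rewrite natrM -/a.
have h5 : (a * ln L%:R + 3 + lambda / 2 * (l0norm AQ)%:R) / m%:R <=
    ((21 * v + 23 / 2 * u) * l * (a + z)) / m%:R.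
  rewrite ler_pM2r ?invr_gt0//.
  have p1 : 0 <= v * l * a by apply: mulr_ge0; [apply: mulr_ge0|]; lra.
  have p2 : 0 <= u * l * a by apply: mulr_ge0; [apply: mulr_ge0|]; lra.
  have p3 : 0 <= v * l * z by apply: mulr_ge0; [apply: mulr_ge0|]; lra.
  have p4 : 0 <= u * l * z by apply: mulr_ge0; [apply: mulr_ge0|]; lra.
  lra.
have h6 : u * l * (a / m%:R) <= u * l * ((a + z) / m%:R).
  rewrite ler_wpM2l//; first by rewrite mulr_ge0// ltW.
  by rewrite ler_pM2r ?invr_gt0// lerDl.
have -> : (21 / t0 + 12) * (u * l) * ((a + z) / m%:R) =
    ((21 * v + 23 / 2 * u) * l * (a + z)) / m%:R +
    2^-1 * (u * l * ((a + z) / m%:R)).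
  by rewrite /v; field; rewrite !gt_eqF.
rewrite /delta mulrDr mulrDl; lra.
Qed.

End sparse_oracle.

Unset Implicit Arguments.

(* Each bound holds with one numerical constant C on every range
   t0 <= tau * Xmax with t0 > 0. Letting C be uniform as tau * Xmax -> 0 would
   make the statement false: the lower bound 2 (beta + 2) log (n1 \/ n2) on
   lambda does not vanish with tau. *)
Theorem mainTheorem3 (R : realType) (t0 : R) (t0_gt0 : 0 < t0) :
  exists2 C : R, 0 < C &
  forall (n1 n2 r m : nat)
    (Dstar : 'M[R]_(n1, r)) (Astar : 'M[R]_(r, n2)) (Xstar : 'M[R]_(n1, n2))
    (Amax Xmax tau : R)
    (d : measure_display) (T : measurableType d) (P : probability T R)
    (S : T -> {set 'I_n1 * 'I_n2}) (Y Xhat : T -> 'M[R]_(n1, n2)),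
  let N := maxn n1 n2 in
  let gamma := m%:R / (n1 * n2)%:R in
  let beta := beta_par n1 n2 r Amax Xmax in
  let lambda := lambda_par n1 n2 tau Xmax beta in
  let L := Llev n1 n2 beta in
  Xstar = Dstar *m Astar ->
  (r <= n2)%N ->
  `|Dstar| <= 1 -> `|Astar| <= Amax -> `|Xstar| <= Xmax / 2 ->
  0 < Amax -> Amax <= N%:R -> 1 <= Xmax ->
  (4 <= m)%N -> (m <= n1 * n2)%N ->
  0 < tau -> t0 <= tau * Xmax ->
  bernoulli_sampling P gamma S ->
  laplace_observations P tau Xstar S Y ->
  (forall i j, measurable_fun setT (fun w => Xhat w i j)) ->
  (forall w, is_estimate r L Amax Xmax tau lambda (S w) (Y w) (Xhat w)) ->
  (mean_sq_error P Xstar Xhat <=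
     (C * ((tau^-1 + Xmax) ^+ 2 * tau * Xmax *
           ((n1%:R * r%:R + (l0norm Astar)%:R) / m%:R) * ln N%:R))%:E)%E /\
  (forall p : R, 0 < p -> p <= 2^-1 ->
    (forall j, weak_lp_ball p Amax (col j Astar)) ->
    let alpha' := p^-1 - 1 in
    let rate := (n2%:R / m%:R) `^ (alpha' / (alpha' + 1)) in
    (mean_sq_error P Xstar Xhat <=
       (C * ((tau^-1 + Xmax) ^+ 2 * tau * Amax * rate +
             (tau^-1 + Xmax) ^+ 2 * tau * Xmax *
             (n1%:R * r%:R / m%:R + rate) * ln N%:R))%:E)%E).
Proof.
pose c1 := 21 / t0 + 12.
have c10 : 0 < c1 by rewrite addr_gt0// divr_gt0.
have t180 : 0 < 18 / t0 by rewrite divr_gt0.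
(* Part (1) uses 16 c1. In part (2), 32 c1 comes from the factor 2 in the number of kept entries, 16
   from the tail bias, and 18 / t0 from the trivial error bound, as (3/2)^2 = 18 / t0 * (t0 / 8). *)
exists (32 * c1 + 16 + 18 / t0); first by rewrite !addr_gt0// mulr_gt0.
set C := _ + _ + _.
move=> n1 n2 r m Dstar Astar Xstar Amax Xmax tau d T P S Y Xhat N gamma beta
  lambda L XE rn2 D1 A1 X1 A0 AN Xm1 m4 mn tau0 t0X HS HY mXhat est.
have n4 : (4 <= n1 * n2)%N := leq_trans m4 mn.
have NR : 1 <= N%:R :> R by rewrite ler1n (leq_trans _ (dim_ge2 n4)).
have l0 : 0 <= ln N%:R :> R by exact: ln_ge0.
have Xm0 : 0 < Xmax by exact: lt_le_trans Xm1.
have mR : 0 < m%:R :> R by rewrite ltr0n (leq_trans _ m4).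
have C0 : 0 <= C by rewrite /C; lra.
have tau_ge0 := ltW tau0; have X_ge0 := ltW Xm0; have A_ge0 := ltW A0.
have mI : 0 <= m%:R^-1 :> R by rewrite invr_ge0 ltW.
have Bb : 0 <= tau^-1 + Xmax by rewrite addr_ge0// invr_ge0.
have B0 : 0 <= (tau^-1 + Xmax) ^+ 2 by exact: sqr_ge0.
have u0 : 0 <= tau * Xmax by rewrite mulr_ge0// ltW.
have nr0 : 0 <= n1%:R * r%:R / m%:R :> R by rewrite !mulr_ge0.
have [r0|r0] := posnP r.
  have mse0 := mean_sq_error_rank0 P XE m4 mn mXhat est r0.
  split => [|p p0 p2 wA /=]; apply: le_trans mse0 _; rewrite lee_fin.
    by rewrite mulr_ge0// !mulr_ge0.
  have rt0 := powR_ge0 (n2%:R / m%:R : R) ((p^-1 - 1) / (p^-1 - 1 + 1)).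
  by apply: mulr_ge0 => //; apply: addr_ge0; rewrite !mulr_ge0// ?addr_ge0.
have risk K e := sparse_oracle_risk XE rn2 D1 A1 X1 A0 AN Xm1 m4 mn tau0 t0_gt0
  t0X HS HY mXhat est (K := K) (e := e) r0.
split => [|p p0 p2 wA /=].
  have X4 : 0 <= Xmax / 4 by rewrite divr_ge0// ltW.
  (* The kept set is the support of A*, so nothing is truncated and e = 0. *)
  have supp j : \sum_(k | (k, j) \notin
      [set ij | Astar ij.1 ij.2 != 0]%SET) `|Astar k j| <= 0.
    by rewrite big1// => k; rewrite inE negbK => /eqP ->; rewrite normr0.
  apply: le_trans (risk _ 0 (lexx 0) X4 supp) _.
  rewrite lee_fin mulr0 mul0r addr0 -/(l0norm Astar) -/c1.
  set z := (_ + _) / m%:R.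
  have z0 : 0 <= z by rewrite mulr_ge0// addr_ge0// ?mulr_ge0.
  rewrite [X in X <= _](_ : _ = 16 * c1 *
    ((tau^-1 + Xmax) ^+ 2 * tau * Xmax * z * ln N%:R)); last by ring.
  apply: ler_wpM2r; last by rewrite /C; lra.
  by rewrite !mulr_ge0.
set al := p^-1 - 1.
set rate := (n2%:R / m%:R) `^ _.
have rate0 : 0 <= rate by exact: powR_ge0.
have n20 : (0 < n2)%N by case: (n2) n4 => //; rewrite muln0.
have [k kn kt] := truncation_level n20 (leq_trans (isT : (0 < 4)%N) m4) p0 p2.
rewrite -/al -/rate in kn kt.
have [K Kk Kt] := weak_lp_truncation_mx k p0 p2 (ltW A0) wA.
have KR : #|K|%:R / m%:R <= 2 * rate.
  rewrite ler_pdivrMr//; apply: le_trans kn.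
  by rewrite -natrM ler_nat.
have Ar0 : 0 <= Amax * rate by rewrite mulr_ge0.
set B := (tau^-1 + Xmax) ^+ 2 in B0 *.
have b1 : 0 <= B * tau * Amax * rate by rewrite !mulr_ge0.
have b2 : 0 <= B * tau * Xmax * (n1%:R * r%:R / m%:R + rate) * ln N%:R.
  by rewrite !mulr_ge0// ?addr_ge0.
have [eX|eX] := leP (2 * (Amax * rate)) (Xmax / 4).
  have e0 : 0 <= 2 * (Amax * rate) by rewrite mulr_ge0.
  have Ke j : \sum_(i | (i, j) \notin K) `|Astar i j| <= 2 * (Amax * rate).
    apply: le_trans (Kt j) _; rewrite mulrCA.
    by apply: ler_wpM2l => //; exact: ltW.
  apply: le_trans (risk _ _ e0 eX Ke) _.
  rewrite lee_fin -/B -/c1.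
  have h : (n1%:R * r%:R + #|K|%:R) / m%:R <=
      2 * (n1%:R * r%:R / m%:R + rate) by rewrite mulrDl; lra.
  have h' : c1 * (tau * Xmax * ln N%:R) * ((n1%:R * r%:R + #|K|%:R) / m%:R) <=
      c1 * (tau * Xmax * ln N%:R) * (2 * (n1%:R * r%:R / m%:R + rate)).
    by apply: ler_wpM2l => //; rewrite !mulr_ge0// ltW.
  apply: (@le_trans _ _ (16 * B * (c1 * (tau * Xmax * ln N%:R) *
      (2 * (n1%:R * r%:R / m%:R + rate)) + tau * (2 * (Amax * rate)) / 2))).
    by apply: ler_wpM2l; [rewrite mulr_ge0 | rewrite lerD2r].
  rewrite [X in X <= _](_ : _ = 16 * (B * tau * Amax * rate) + 32 * c1 *
    (B * tau * Xmax * (n1%:R * r%:R / m%:R + rate) * ln N%:R)); last by field; rewrite ?(gt_eqF mR) ?(gt_eqF t0_gt0) ?(gt_eqF tau0).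
  rewrite [X in _ <= X]mulrDr; apply: lerD; apply: ler_wpM2r => //.
    by rewrite /C; have := ltW c10; lra.
  by rewrite /C; lra.
(* The truncated matrix may now violate the bound Xmax of the class, but then
   Amax * rate is of order Xmax and the trivial bound on the error suffices. *)
apply: le_trans (mean_sq_error_le_trivial P X1 Xm1 m4 mn mXhat est) _.
rewrite lee_fin.
have hX : Xmax ^+ 2 <= B.
  rewrite /B lerXn2r ?nnegrE ?addr_ge0 ?invr_ge0 ?(ltW tau0) ?(ltW Xm0)//.
  by rewrite lerDr invr_ge0 ltW.
apply: (@le_trans _ _ (18 / t0 * (B * tau * Amax * rate))); last first.
  apply: ler_pM => //; [exact: ltW | | by rewrite lerDl].
  by rewrite /C lerDr addr_ge0// mulr_ge0// ltW.
have t0n : t0 != 0 by rewrite gt_eqF.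
have hA : t0 / 8 <= tau * (Amax * rate).
  have : tau * (Xmax / 4) <= tau * (2 * (Amax * rate)).
    by apply: ler_wpM2l; exact: ltW.
  move: t0X; lra.
apply: (@le_trans _ _ (18 / t0 * (Xmax ^+ 2 * (t0 / 8)))).
  rewrite [X in _ <= X](_ : _ = 9 / 4 * Xmax ^+ 2); last by field.
  by rewrite exprMn ler_wpM2r ?sqr_ge0//; lra.
apply: ler_wpM2l; first exact: ltW.
have -> : B * tau * Amax * rate = B * (tau * (Amax * rate)) by rewrite !mulrA.
by apply: ler_pM => //; [exact: sqr_ge0 | rewrite divr_ge0// ltW].
Qed.
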